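(* Fix finite collocation sets $\Omega^h=\{z_{\mathcal F}^i\}_{i=1}^{N_{\mathcal F}}\subset\Omega$ and $\Gamma^h=\{z_{\mathcal B}^j\}_{j=1}^{N_{\mathcal B}}\subset\Gamma$. Let $\mathcal H\subset U^h$ be a class of (restrictions to $\overline\Omega$ of) depth-$L$ neural networks $\mathbb{R}^d\to\mathbb{R}^c$ with arbitrary hidden-layer widths satisfying one of the following: (i) $\mathcal H=\mathcal H_{\mathrm{reg}}$ consists of all depth-$L$ neural networks with ReLU activation that are $C^{r_{\max}}$ at all collocation points, $r_{\max}=\max(r_{\mathcal F},r_{\mathcal B})$, and $L\ge\lceil\log_2(d+1)\rceil+1$. (ii) $\mathcal H$ consists of all depth-$L$ neural networks with activation $\sigma\in C^{\ell}(\mathbb{R},\mathbb{R})$, $\ell:=N_{\mathcal F}(r_{\mathcal F}+1)+N_{\mathcal B}(r_{\mathcal B}+1)$, where $\sigma^{(k)}(a)\ne0$ for some $a\in\mathbb{R}$ and all $0\le k\le\ell$, and $L\ge2$; if $L>2$, additionally $\sigma$ is strictly monotone. Assume $u_\theta\in\arg\min_{u\in\mathcal H}\mathcal J^h(u)$. Then there exists a nontrivial function $\Phi\in\mathcal H$, vanishing together with all derivatives required by the PDE and boundary operators at all interior and boundary collocation points (i.e. $D^\beta\Phi(z_{\mathcal F}^i)=0$ for $|\beta|\le r_{\mathcal F}$ and all $i$, and $D^\gamma\Phi(z_{\mathcal B}^j)=0$ for $|\gamma|\le r_{\mathcal B}$ and all $j$), such that $u_\theta+\lambda\Phi\in\mathcal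 H$ is a minimizer of $\mathcal J^h$ over $\mathcal H$ for every $\lambda\in\mathbb{R}$. Moreover, if $\hat u\in U$ satisfies $\mathcal F(\hat u)=0$ in $\Omega$ and $\mathcal B(\hat u)=0$ on $\Gamma$, then for any $p\in[1,\infty)$ $$\|u_\theta+\lambda\Phi-\hat u\|_{L^p(\Omega)}\ \ge\ |\lambda|\,\|\Phi\|_{L^p(\Omega)}-\|u_\theta-\hat u\|_{L^p(\Omega)}\ \longrightarrow\ \infty\qquad\text{as }|\lambda|\to\infty .$$
   Context: Setting. $d,c,c_{\mathcal F},c_{\mathcal B},N_{\mathcal F},N_{\mathcal B}\in\mathbb{N}$, $r_{\mathcal F},r_{\mathcal B}\in\mathbb{N}_0$, $\nu\in[1,\infty)$. $\Omega\subset\mathbb{R}^d$ is a bounded domain (open, connected) with Lipschitz boundary, $\Gamma\subseteq\partial\Omega$. $U\subseteq C^{r_{\mathcal F}}(\Omega,\mathbb{R}^c)\cap C^{r_{\mathcal B}}(\overline\Omega,\mathbb{R}^c)$ is a Banach space of functions $\overline\Omega\to\mathbb{R}^c$; $\mathcal F$ and $\mathcal B$ are (possibly nonlinear) local differential operators on $U$ given by $\mathcal F(u)(z)=F(z,\{D^\beta u(z):|\beta|\le r_{\mathcal F}\})\in\mathbb{R}^{c_{\mathcal F}}$, $z\in\Omega$, and $\mathcal B(u)(z)=B(z,\{D^\beta u(z):|\beta|\le r_{\mathcal B}\})\in\mathbb{R}^{c_{\mathcal B}}$, $z\in\Gamma$, for given functions $F,B$. Node-regular space: $U^h$ is the set of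 functions $u:\overline\Omega\to\mathbb{R}^c$ such that $D^\beta u$ exists classically on $\Omega^h$ for $|\beta|\le r_{\mathcal F}$ and on $\Gamma^h$ for $|\beta|\le r_{\mathcal B}$. For $u\in U^h$ the quantities $\widehat{\mathcal F}(u)(z)$, $z\in\Omega^h$, and $\widehat{\mathcal B}(u)(z)$, $z\in\Gamma^h$, are defined by the same formulas with $F$ and $B$. AD-PINN functional. Let $\mathcal D^h\subseteq\Omega^h\cup\Gamma^h$ with given data $u^*(z)\in\mathbb{R}^c$, $z\in\mathcal D^h$; $\alpha_{\mathcal F},\alpha_{\mathcal B},\alpha_{\mathcal D}\ge0$; $\omega_{\mathcal F}^z,\omega_{\mathcal B}^z,\omega_{\mathcal D}^z\in\mathbb{R}$ quadrature weights. For $u\in U^h$, $$\mathcal J^h(u)=\alpha_{\mathcal F}\sum_{z\in\Omega^h}\omega_{\mathcal F}^z|\widehat{\mathcal F}(u)(z)|_\nu^\nu+\alpha_{\mathcal B}\sum_{z\in\Gamma^h}\omega_{\mathcal B}^z|\widehat{\mathcal B}(u)(z)|_\nu^\nu+\alpha_{\mathcal D}\sum_{z\in\mathcal D^h}\omega_{\mathcal D}^z|u(z)-u^*(z)|_\nu^\nu ,$$ where $|\cdot|_\nu$ is the $\ell^\nu$-norm. Minimizers are global minimizers. Neural networks. A depth-$L$ neural network with activation $\sigma:\mathbb{R}\to\mathbb{R}$ is a map $f:\mathbb{R}^d\to\mathbb{R}^c$ of the form $\varphi_0(x)=x$, $\varphi_i(x)=\sigma(W_i\varphi_{i-1}(x)+b_i)$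 for $i=1,\dots,L-1$ ($\sigma$ componentwise), $f(x)=W_L\varphi_{L-1}(x)+b_L$, with $W_i\in\mathbb{R}^{d_i\times d_{i-1}}$, $b_i\in\mathbb{R}^{d_i}$, $d_0=d$, $d_L=c$ and hidden widths $d_1,\dots,d_{L-1}\in\mathbb{N}$ arbitrary. ReLU is $\sigma(x)=\max\{0,x\}$. *)

(* Defs.v *)
From HB Require Import structures.
From mathcomp Require Import all_boot all_order all_algebra.
From mathcomp Require Import all_classical all_reals all_analysis.

Set Implicit Arguments.
Unset Strict Implicit.
Unset Printing Implicit Defensive.

Import Order.TTheory GRing.Theory Num.Theory.
Import numFieldNormedType.Exports.

Local Open Scope classical_set_scope.
Local Open Scope ring_scope.

Section Domain.
Context {R : realType} {d : nat}.

Definition dotp (x y : 'cV[R]_d) : R := \sum_i x i 0 * y i 0.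

(* Near every boundary point, in Cartesian coordinates with last axis [e], the
   set is the strict epigraph of a Lipschitz function [g] defined on the
   hyperplane orthogonal to [e]. *)
Definition lipschitz_boundary (Om : set 'cV[R]_d) : Prop :=
  forall z, (closure Om `\` Om°) z ->
  exists (e : 'cV[R]_d) (g : 'cV[R]_d -> R) (k r : R),
    [/\ dotp e e = 1, 0 < r, k.-lipschitz_[set x | dotp x e = 0] g &
      forall x, ball z r x ->
        (Om x <-> g (x - dotp x e *: e) < dotp x e)].

Definition bounded_lipschitz_domain (Om : set 'cV[R]_d) : Prop :=
  [/\ open Om, connected Om, Om !=set0, bounded_set Om &
      lipschitz_boundary Om].

End Domain.

Section MultiIndex.
Context {d : nat}.

Definition mdeg (b : {ffun 'I_d -> nat}) : nat := (\sum_i b i)%N.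

Definition multiindex (k : nat) := {b : {ffun 'I_d -> nat} | (mdeg b <= k)%N}.

(* The directions of D^b = d_0^(b 0) d_1^(b 1) ... : the head of the list is the
   direction differentiated last. *)
Definition mi_dirs (b : {ffun 'I_d -> nat}) : seq 'I_d :=
  flatten [seq nseq (b i) i | i <- enum 'I_d].

End MultiIndex.
Arguments multiindex : clear implicits.

Section Derivatives.
Context {R : realType} {d c : nat}.
Implicit Types (f : 'cV[R]_d -> 'cV[R]_c) (s : seq 'I_d).

Fixpoint pderiv s f : 'cV[R]_d -> 'cV[R]_c :=
  if s is i :: s' then fun x => 'D_(delta_mx i 0) (pderiv s' f) x else f.

Fixpoint pderivable s f (x : 'cV[R]_d) : Prop :=
  if s is i :: s' then
    (\forall y \near x, pderivable s' f y) /\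
    derivable (pderiv s' f) x (delta_mx i 0)
  else True.

(* [f] is C^k at [z] when it is C^k on a neighbourhood of [z]. *)
Definition Ck_at (k : nat) f (z : 'cV[R]_d) : Prop :=
  \forall x \near z, forall b : multiindex d k,
    pderivable (mi_dirs (sval b)) f x /\
    {for x, continuous (pderiv (mi_dirs (sval b)) f)}.

(* Functions on the closure of [Om].  Derivatives at points of [Om] are the
   classical iterated partial derivatives; derivatives of positive order at
   boundary points are, as in the definition of C^k(closure Om), the limits of
   the derivatives taken from inside [Om]. *)
Variable Om : set 'cV[R]_d.
Implicit Type u : closure Om -> 'cV[R]_c.

Definition mderivable (b : {ffun 'I_d -> nat}) u (z : 'cV[R]_d) : Prop :=
  let s := mi_dirs b in let v := 'valL_ 0 u in
  if (mdeg b == 0)%N || (z \in Om) then pderivable s v z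
  else (\forall x \near within Om (nbhs z), pderivable s v x) /\
       cvg (pderiv s v @ within Om (nbhs z)).

Definition mderiv (b : {ffun 'I_d -> nat}) u (z : 'cV[R]_d) : 'cV[R]_c :=
  let s := mi_dirs b in let v := 'valL_ 0 u in
  if (mdeg b == 0)%N || (z \in Om) then pderiv s v z
  else lim (pderiv s v @ within Om (nbhs z)).

(* [Ck_on Om k] is C^k(Om) and [Ck_on (closure Om) k] is C^k(closure Om). *)
Definition Ck_on (A : set 'cV[R]_d) (k : nat) u : Prop :=
  forall b : multiindex d k,
    (forall z, A z -> mderivable (sval b) u z) /\
    {within A, continuous (mderiv (sval b) u)}.

Definition local_op (k m : nat)
    (F : 'cV[R]_d -> (multiindex d k -> 'cV[R]_c) -> 'cV[R]_m)
    u (z : 'cV[R]_d) : 'cV[R]_m :=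
  F z (fun b => mderiv (sval b) u z).

Definition node_regular (rF rB : nat) (Oh Gh : set 'cV[R]_d) :
    set (closure Om -> 'cV[R]_c) :=
  [set u | (forall z, Oh z ->
              forall b : multiindex d rF, mderivable (sval b) u z) /\
           (forall z, Gh z ->
              forall b : multiindex d rB, mderivable (sval b) u z)].

End Derivatives.

Section LebesgueTuple.
Context {R : realType}.
Local Open Scope ereal_scope.
Local Notation Rn n := (n.-tuple (measurableTypeR R)).

Definition cons_pair (n : nat) (x : Rn n * measurableTypeR R) : Rn n.+1 :=
  [the _.-tuple _ of x.2 :: x.1].

Lemma measurable_cons_pair n : measurable_fun [set: _] (@cons_pair n).
Proof. exact: measurable_cons. Qed.

(* n-dimensional Lebesgue measure, as the n-fold product of the
   one-dimensional one. *)
Fixpoint lebesgue_tuple (n : nat) : set (Rn n) -> \bar R :=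
  match n with
  | 0 => \d_([tuple])
  | n'.+1 => pushforward (@lebesgue_tuple n' \x (@lebesgue_measure R))
               (@cons_pair n')
  end.

Lemma lebesgue_tuple_measure n :
  exists mu : {measure set (Rn n) -> \bar R}, @lebesgue_tuple n = mu.
Proof.
elim: n => [|n [mu muE]] /=; first by exists \d_([tuple]).
rewrite muE; unshelve eexists.
  unshelve refine (pushforward (mu \x (@lebesgue_measure R)) (@cons_pair n)
    : {measure set _ -> \bar R}).
  exact: measurable_cons_pair.
by [].
Qed.

Let lebesgue_tuple0 n : @lebesgue_tuple n set0 = 0.
Proof. by have [mu ->] := lebesgue_tuple_measure n; exact: measure0. Qed.

Let lebesgue_tuple_ge0 n A : 0 <= @lebesgue_tuple n A.
Proof. by have [mu ->] := lebesgue_tuple_measure n; exact: measure_ge0. Qed.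

Let lebesgue_tuple_sigma_additive n : semi_sigma_additive (@lebesgue_tuple n).
Proof.
by have [mu ->] := lebesgue_tuple_measure n; exact: measure_semi_sigma_additive.
Qed.

HB.instance Definition _ n := isMeasure.Build _ _ _ (@lebesgue_tuple n)
  (@lebesgue_tuple0 n) (@lebesgue_tuple_ge0 n)
  (@lebesgue_tuple_sigma_additive n).

End LebesgueTuple.
Arguments lebesgue_tuple R n A : clear implicits.

Section Norms.
Context {R : realType}.

Definition lnorm (n : nat) (p : R) (x : 'cV[R]_n) : R :=
  (\sum_i `|x i 0| `^ p) `^ p^-1.

(* The L^p(Om)-norm; values in R^c are measured in the Euclidean norm. *)
Definition Lp_norm (d c : nat) (Om : set 'cV[R]_d) (p : R)
    (u : closure Om -> 'cV[R]_c) : \bar R :=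
  let pt (t : d.-tuple (measurableTypeR R)) : 'cV[R]_d :=
    \col_i (tnth t i : R) in
  'N[lebesgue_tuple R d]_(p%:E)
    [(fun t => (lnorm 2 ('valL_ 0 u (pt t)))%:E) \_ [set t | Om (pt t)]].

(* The filter of neighbourhoods of |x| = +oo. *)
Definition abs_pinfty : set_system R :=
  [set A | exists M, forall x, M < `|x| -> A x].

End Norms.

Section Networks.
Context {R : realType}.

Definition relu (x : R) : R := Num.max 0 x.

(* [hidden sigma i phi]: [phi : R^d -> R^n] is an [i]-th layer map. *)
Inductive hidden (sigma : R -> R) (d : nat) :
    nat -> forall n, ('cV[R]_d -> 'cV[R]_n) -> Prop :=
| hidden0 : hidden sigma 0 (fun x : 'cV[R]_d => x)
| hiddenS i m n (phi : 'cV[R]_d -> 'cV[R]_m) (W : 'M[R]_(n, m)) (b : 'cV[R]_n) :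
    (0 < n)%N -> hidden sigma i phi ->
    hidden sigma i.+1 (fun x => map_mx sigma (W *m phi x + b)).

Definition neural_network (sigma : R -> R) (d c L : nat)
    (f : 'cV[R]_d -> 'cV[R]_c) : Prop :=
  exists (l m : nat) (phi : 'cV[R]_d -> 'cV[R]_m) (W : 'M[R]_(c, m))
    (b : 'cV[R]_c),
    [/\ L = l.+1, hidden sigma l phi & f = (fun x => W *m phi x + b)].

Definition relu_reg_class (d c L r : nat) (Om Nodes : set 'cV[R]_d) :
    set (closure Om -> 'cV[R]_c) :=
  [set sigL (closure Om) f | f in
    [set f | neural_network relu L f /\ forall z, Nodes z -> Ck_at r f z]].

Definition network_class (sigma : R -> R) (d c L : nat) (Om : set 'cV[R]_d) :
    set (closure Om -> 'cV[R]_c) :=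
  [set sigL (closure Om) f | f in [set f | neural_network sigma L f]].

Definition Ck_real (k : nat) (sigma : R -> R) : Prop :=
  (forall i x, (i < k)%N -> derivable (derive1n i sigma) x 1) /\
  (forall i, (i <= k)%N -> continuous (derive1n i sigma)).

Definition strictly_monotone (sigma : R -> R) : Prop :=
  {homo sigma : x y / x < y} \/ {homo sigma : x y /~ x < y}.

End Networks.
Arguments relu_reg_class {R d c} L r Om Nodes.
Arguments network_class {R} sigma {d c} L Om.

Section Loss.
Context {R : realType} {d c cF cB rF rB : nat}.

Definition pinn_loss (nu : R) (Om : set 'cV[R]_d)
    (F : 'cV[R]_d -> (multiindex d rF -> 'cV[R]_c) -> 'cV[R]_cF)
    (B : 'cV[R]_d -> (multiindex d rB -> 'cV[R]_c) -> 'cV[R]_cB)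
    (Oh Gh Dh : set 'cV[R]_d) (aF aB aD : R) (wF wB wD : 'cV[R]_d -> R)
    (ustar : 'cV[R]_d -> 'cV[R]_c) (u : closure Om -> 'cV[R]_c) : R :=
  aF * (\sum_(z \in Oh) wF z * lnorm nu (local_op F u z) `^ nu) +
  aB * (\sum_(z \in Gh) wB z * lnorm nu (local_op B u z) `^ nu) +
  aD * (\sum_(z \in Dh) wD z * lnorm nu ('valL_ 0 u z - ustar z) `^ nu).

End Loss.

Definition minimizer {R : realType} {T : Type} (J : T -> R) (H : set T) (u : T)
    : Prop :=
  H u /\ forall v, H v -> J u <= J v.

(* Main.v *)
Require Import Defs.
From mathcomp Require Import all_boot all_order all_algebra.
From mathcomp Require Import all_classical all_reals all_analysis.
From mathcomp Require Import measurable_realfun ring lra.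

Set Implicit Arguments.
Unset Strict Implicit.
Unset Printing Implicit Defensive.

Import Order.TTheory GRing.Theory Num.Theory.
Import numFieldNormedType.Exports.

Local Open Scope classical_set_scope.
Local Open Scope ring_scope.

(** The loss only sees a function through its derivatives at finitely many
    points, so a network that is flat to the required order at these points
    can be added to a minimizer, in any amount, without changing the loss;
    since networks of a fixed depth and free widths form a vector space
    ([hidden_join], [neural_network_lincomb]), the sum stays in the class.

    The flat network is a ridge function [x |-> g (x i) *: e] of one
    coordinate.  All its partial derivatives are derivatives of [g]
    ([pderiv_ridge]), so only a one-variable problem remains.
    - For ReLU, [g] is a hat function supported away from the finitely many
      values that the coordinate takes at the nodes ([relu_flat_network]).  A
      hat is a combination of three ReLUs, and being nonnegative it passes
      unchanged through further ReLU layers, which gives any depth at least 2.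
    - For a smooth activation, let [tau] be the iterate of [sigma] through the
      first hidden layers, and take for [g] a combination of the [l + 1]
      functions [t |-> sigma (a + k * (tau t - y0))], [k = 0, ..., l].
      Flatness at the nodes is [l] linear equations on the [l + 1]
      coefficients, hence has a nonzero solution ([underdetermined_system]).
      If the resulting network vanished on the domain, the combination of the
      [sigma (a + k * (y - y0))] would vanish for [y] near [y0], because the
      strictly monotone [tau] is open; its derivatives at [y0] then form a
      Vandermonde system and all coefficients vanish ([ridge_lincomb_eq0]).

    Growth of the L^p distance is the triangle inequality, once the norms are
    known to be finite and the norm of the flat network to be positive.  Both
    follow from the measure of cubes: the domain sits inside a cube, and a
    continuous function that is nonzero at a point is nonzero on a cube
    around it ([Lp_norm_fin], [Lp_norm_gt0], [Lp_norm_growth]). *)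

(** * Continuously differentiable functions of one variable *)

Section CkReal.
Context {R : realType}.

Lemma cvg_bigsum (T : Type) (G : set_system T) {FG : Filter G}
    (V : normedModType R) n (f : 'I_n -> T -> V) (l : 'I_n -> V) :
  (forall i, f i @ G --> l i) ->
  (fun t => \sum_i f i t) @ G --> \sum_i l i.
Proof.
elim: n f l => [|n IH] f l fl.
  rewrite big_ord0 (_ : (fun t => _) = fun=> 0); first exact: cvg_cst.
  by apply/funext => t; rewrite big_ord0.
rewrite big_ord_recl (_ : (fun t => _) = f ord0 \+ (fun t => \sum_i f (lift ord0 i) t)).
  by apply: cvgD; [exact: fl|apply: IH => i; exact: fl].
by apply/funext => t; rewrite big_ord_recl.
Qed.

Implicit Types f g : R -> R.

Lemma derivable_continuous1 f (x : R) : derivable f x 1 -> {for x, continuous f}.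
Proof. by move=> /derivable1_diffP /differentiable_continuous. Qed.

Lemma Ck_real0 f : Ck_real 0 f <-> continuous f.
Proof.
split=> [[_ /(_ 0%N)]|cf]; first by apply.
by split=> // -[|].
Qed.

(** The recursive form of the class, which turns closure under products and
    composition into inductions on the order of differentiability. *)
Lemma Ck_realS k f :
  Ck_real k.+1 f <-> (forall x, derivable f x 1) /\ Ck_real k (derive1 f).
Proof.
split=> [[df cf]|[df [df' cf']]].
  split=> [x|]; first exact: (df 0%N x).
  split=> [i x ik|i ik]; rewrite -derive1Sn; first exact: df.
  exact: cf.
split=> [[|i] x ik|[|i] ik]; rewrite ?derive1Sn; [exact: df|exact: df'| |].
  by move=> x; apply: derivable_continuous1; exact: df.
exact: cf'.
Qed.

Lemma Ck_real_le j k f : (j <= k)%N -> Ck_real k f -> Ck_real j f.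
Proof.
move=> jk [df cf]; split=> i; first by move=> x ij; apply: df; exact: leq_trans ij jk.
by move=> ij; apply: cf; exact: leq_trans ij jk.
Qed.

Lemma Ck_real_continuous k f : Ck_real k f -> continuous f.
Proof. by move=> /(Ck_real_le (leq0n k)) /Ck_real0. Qed.

Lemma Ck_realD k f g : Ck_real k f -> Ck_real k g -> Ck_real k (f + g).
Proof.
elim: k f g => [|k IH] f g.
  by move=> /Ck_real0 cf /Ck_real0 cg; apply/Ck_real0 => x; apply: continuousD;
    [exact: cf|exact: cg].
move=> /Ck_realS[df Cf] /Ck_realS[dg Cg]; apply/Ck_realS; split=> [x|].
  exact: derivableD.
have -> : derive1 (f + g) = derive1 f + derive1 g.
  by apply/funext => x; rewrite derive1E (deriveD (df x) (dg x)) -!derive1E.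
exact: IH.
Qed.

Lemma Ck_realM k f g : Ck_real k f -> Ck_real k g -> Ck_real k (f * g).
Proof.
elim: k f g => [|k IH] f g.
  by move=> /Ck_real0 cf /Ck_real0 cg; apply/Ck_real0 => x; apply: continuousM;
    [exact: cf|exact: cg].
move=> Cf Cg.
have [df Cf'] := (Ck_realS k f).1 Cf.
have [dg Cg'] := (Ck_realS k g).1 Cg.
apply/Ck_realS; split=> [x|]; first exact: derivableM.
have -> : derive1 (f * g) = f * derive1 g + g * derive1 f.
  by apply/funext => x; rewrite derive1E (deriveM (df x) (dg x)) -!derive1E.
by apply: Ck_realD; apply: IH => //; apply: (Ck_real_le (leqnSn k)).
Qed.

Lemma Ck_real_comp k f g : Ck_real k f -> Ck_real k g -> Ck_real k (f \o g).
Proof.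
elim: k f g => [|k IH] f g.
  move=> /Ck_real0 cf /Ck_real0 cg; apply/Ck_real0 => x; apply: continuous_comp;
    [exact: cg|exact: cf].
move=> Cf Cg.
have [df Cf'] := (Ck_realS k f).1 Cf.
have [dg Cg'] := (Ck_realS k g).1 Cg.
apply/Ck_realS; split=> [x|].
  apply/derivable1_diffP; apply: differentiable_comp; exact/derivable1_diffP.
have -> : derive1 (f \o g) = (derive1 f \o g) * derive1 g.
  by apply/funext => x; rewrite derive1_comp.
have Cgk := Ck_real_le (leqnSn k) Cg.
exact: (Ck_realM (IH _ _ Cf' Cgk) Cg').
Qed.

Lemma Ck_real_cst k (b : R) : Ck_real k (fun=> b).
Proof.
elim: k b => [|k IH] b; first by apply/Ck_real0 => x; exact: cvg_cst.
apply/Ck_realS; split=> [x|]; first exact: derivable_cst.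
rewrite (_ : derive1 _ = fun=> 0); first exact: IH.
by apply/funext => x; rewrite derive1_cst.
Qed.

Lemma is_derive_affine (a b x : R) : is_derive x 1 (fun t : R => a * t + b) a.
Proof.
apply: (@is_derive_eq _ _ _ (a \*: id + cst b) x 1 _ (a *: 1 + 0)).
by rewrite addr0 /GRing.scale/= mulr1.
Qed.

Lemma Ck_real_affine k (a b : R) : Ck_real k (fun t => a * t + b).
Proof.
case: k => [|k].
  apply/Ck_real0 => x; apply: derivable_continuous1.
  by case: (is_derive_affine a b x).
apply/Ck_realS; split=> [x|]; first by case: (is_derive_affine a b x).
rewrite (_ : derive1 _ = fun=> a); first exact: Ck_real_cst.
by apply/funext => x; rewrite derive1E; case: (is_derive_affine a b x).
Qed.

Lemma Ck_real_iter k f n : Ck_real k f -> Ck_real k (iter n f).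
Proof.
move=> Cf; elim: n => [|n IH].
  rewrite (_ : iter 0 f = fun t => 1 * t + 0); first exact: Ck_real_affine.
  by apply/funext => t/=; rewrite mul1r addr0.
exact: (Ck_real_comp Cf IH).
Qed.

Lemma is_derive_lincomb n (c : 'I_n -> R) (f : 'I_n -> R -> R) (x : R) :
  (forall i, derivable (f i) x 1) ->
  is_derive x 1 (fun t => \sum_i c i * f i t) (\sum_i c i * derive1 (f i) x).
Proof.
move=> df.
have := @is_derive_sum _ _ _ n (fun i => c i \*: f i) x 1 (fun i => c i *: derive1 (f i) x).
rewrite fct_sumE; apply => i; apply: is_deriveZ; rewrite derive1E; exact: derivableP.
Qed.

Lemma derive1n_lincomb k n (c : 'I_n -> R) (f : 'I_n -> R -> R) :
  (forall i, Ck_real k (f i)) -> forall j, (j <= k)%N ->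
  derive1n j (fun t => \sum_i c i * f i t) = (fun t => \sum_i c i * derive1n j (f i) t).
Proof.
move=> Cf; elim=> [//|j IH] jk.
rewrite derive1nS IH ?(ltnW jk)//; apply/funext => x; rewrite derive1E.
have [] := @is_derive_lincomb n c (fun i => derive1n j (f i)) x; last by [].
by move=> i; have [df _] := Cf i; exact: df.
Qed.

Lemma Ck_real_lincomb k n (c : 'I_n -> R) (f : 'I_n -> R -> R) :
  (forall i, Ck_real k (f i)) -> Ck_real k (fun t => \sum_i c i * f i t).
Proof.
move=> Cf; split=> [j x jk|j jk]; rewrite (derive1n_lincomb c Cf) ?(ltnW jk)//.
  have [] := @is_derive_lincomb n c (fun i => derive1n j (f i)) x; last by [].
  by move=> i; have [df _] := Cf i; exact: df.
move=> x; apply: cvg_bigsum => i; apply: cvgM; first exact: cvg_cst.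
by have [_ cf] := Cf i; apply: cf.
Qed.

End CkReal.

(** * Linear independence of dilated activations *)

Section LinearIndependence.
Context {R : realType}.

(** Differentiating the identity [j] times at [y0] gives
    [sum_i c i * i ^ j * sigma^(j) a = 0]; dividing by the nonzero
    [sigma^(j) a] for [j = 0, ..., k] leaves a Vandermonde system with the
    distinct nodes [0, ..., k]. *)
Lemma ridge_lincomb_eq0 k (sigma : R -> R) (a y0 : R) (c : 'I_k.+1 -> R) :
  Ck_real k sigma -> (forall j, (j <= k)%N -> derive1n j sigma a != 0) ->
  (\forall y \near y0, \sum_(i < k.+1) c i * sigma (i%:R * y + (a - i%:R * y0)) = 0) ->
  forall i, c i = 0.
Proof.
move=> [ds _] sa0 near0.
have dernear j : (j <= k)%N -> \forall y \near y0,
    \sum_(i < k.+1) c i * (i%:R ^+ j *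
      derive1n j sigma (i%:R * y + (a - i%:R * y0))) = 0.
  elim: j => [_|j IH jk].
    by apply: filterS near0 => y ny; rewrite -[RHS]ny; apply: eq_bigr => i _; rewrite expr0 mul1r.
  have /near_join := IH (ltnW jk); apply: filterS => y ny.
  pose f (i : 'I_k.+1) := fun y : R =>
    derive1n j sigma (i%:R * y + (a - i%:R * y0)).
  have df (i : 'I_k.+1) : is_derive y 1 (f i)
      (derive1n j.+1 sigma (i%:R * y + (a - i%:R * y0)) * i%:R).
    apply: is_derive1_comp; last exact: is_derive_affine.
    rewrite derive1nS derive1E; apply/derivableP; exact: ds.
  have [|_] := @is_derive_lincomb _ _ (fun i => c i * i%:R ^+ j) f y.
    by move=> i; case: (df i).
  under [in X in X -> _]eq_fun => t do
    under eq_bigr do rewrite -mulrA.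
  rewrite (near_eq_derive _ (_ : \near y, _ = cst 0 y)); last exact: ny.
  rewrite derive_cst => /esym sum0; rewrite -[RHS]sum0; apply: eq_bigr => i _.
  rewrite derive1E; have [_ ->] := df i; rewrite exprSr -!mulrA.
  by congr (_ * (_ * _)); rewrite mulrC.
have sys j : (j <= k)%N -> \sum_(i < k.+1) i%:R ^+ j * c i = 0.
  move=> jk; have /nbhs_singleton := dernear j jk.
  under eq_bigr => i _.
    rewrite addrCA subrr addr0 mulrA mulrC (mulrC (c i)); over.
  by rewrite -mulr_sumr => /eqP; rewrite mulf_eq0 (negbTE (sa0 j jk))/= => /eqP.
pose V := Vandermonde k.+1 (\row_(i < k.+1) (i%:R : R)).
have Vu : V \in unitmx.
  rewrite unitmxE det_Vandermonde unitfE.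
  apply/prodf_neq0 => i _; apply/prodf_neq0 => j ij.
  by rewrite !mxE subr_eq0 eqr_nat gtn_eqF.
have Vc : V *m (\col_i c i) = 0.
  apply/colP => j; rewrite !mxE -[RHS](sys j); last by rewrite -ltnS.
  by apply: eq_bigr => i _; rewrite !mxE.
move=> i; have : (\col_i c i) i 0 = 0 :> R; last by rewrite mxE.
by rewrite -(mulKmx Vu (\col_i c i)) Vc mulmx0 mxE.
Qed.

(** The left kernel of a matrix with more rows than columns is nonzero. *)
Lemma underdetermined_system (I : finType) (n : nat) (A : 'I_n -> I -> R) :
  (#|I| < n)%N ->
  exists c : 'I_n -> R, (exists i, c i != 0) /\ forall q, \sum_i c i * A i q = 0.
Proof.
move=> In; pose M := \matrix_(i < n, q < #|I|) A i (enum_val q).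
have /rowV0Pn[v /sub_kermxP vM v0] : kermx M != 0.
  rewrite -mxrank_eq0 mxrank_ker subn_eq0 -ltnNge.
  by apply: leq_ltn_trans In; exact: rank_leq_col.
exists (v 0); split.
  by have /rV0Pn[i vi] := v0; exists i.
move=> q; have := congr1 (fun B : 'rV_#|I| => B 0 (enum_rank q)) vM.
by rewrite !mxE => vq; rewrite -[RHS]vq; apply: eq_bigr => i _; rewrite mxE enum_rankK.
Qed.

Lemma strictly_monotone_iter (sigma : R -> R) n :
  (0 < n)%N -> strictly_monotone sigma -> strictly_monotone (iter n sigma).
Proof.
case: n => // n _ ms; elim: n => [//|n IH].
case: ms => ms; case: IH => IH; [left|right|right|left] => x y xy.
all: exact: (ms _ _ (IH _ _ xy)).
Qed.

(** The intermediate value theorem makes the image of a neighbourhood of [t0]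
    contain the open interval between the images of two points on either side
    of [t0], and strict monotonicity puts [tau t0] inside that interval. *)
Lemma strictly_monotone_open (tau : R -> R) (t0 : R) (P : R -> Prop) :
  continuous tau -> strictly_monotone tau ->
  (\forall t \near t0, P (tau t)) -> \forall y \near tau t0, P y.
Proof.
move=> ct mt /nbhs_ballP[e /= e0 eP].
have e20 : 0 < e / 2 by rewrite divr_gt0.
have lt1 : t0 - e / 2 < t0 by rewrite ltrBlDr ltrDl.
have lt2 : t0 < t0 + e / 2 by rewrite ltrDl.
have le12 : t0 - e / 2 <= t0 + e / 2 by rewrite ltW// (lt_trans lt1).
have key y : Num.min (tau (t0 - e / 2)) (tau (t0 + e / 2)) < y <
    Num.max (tau (t0 - e / 2)) (tau (t0 + e / 2)) -> P y.
  move=> /andP[y1 y2].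
  have [|t tin <-] := @IVT _ tau _ _ y le12 (continuous_subspaceT ct).
    by rewrite !ltW.
  apply: eP; rewrite /ball/= distrC ltr_distl.
  move: tin; rewrite in_itv/= => /andP[t1 t2].
  apply/andP; split; [apply: lt_le_trans t1|apply: le_lt_trans t2 _].
    by rewrite ltrD2l ltrN2 gtr_pMr// invf_lt1// ltr1n.
  by rewrite ltrD2l gtr_pMr// invf_lt1// ltr1n.
have [tau1 tau2] : Num.min (tau (t0 - e / 2)) (tau (t0 + e / 2)) < tau t0 /\
    tau t0 < Num.max (tau (t0 - e / 2)) (tau (t0 + e / 2)).
  by case: mt => mt; rewrite gt_min lt_max (mt _ _ lt1) (mt _ _ lt2) ?orbT.
near=> y; apply: key; apply/andP; split; near: y; first exact: lt_nbhsr.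
exact: lt_nbhsl.
Unshelve. all: by end_near. Qed.

End LinearIndependence.

(** * Closure properties of networks *)

Section NetworkClass.
Context {R : realType}.
Variables (sigma : R -> R) (d : nat).

(** Two networks of the same depth run in parallel on stacked layers, and each
    is recovered by a linear projection.  Sharing a layer [chi] up to linear
    maps, instead of stacking [phi] and [psi], makes the statement hold at
    depth 0 as well, where both are the input itself. *)
Lemma hidden_join i m n (phi : 'cV[R]_d -> 'cV[R]_m) (psi : 'cV[R]_d -> 'cV[R]_n) :
  hidden sigma i phi -> hidden sigma i psi ->
  exists k (chi : 'cV[R]_d -> 'cV[R]_k) (A : 'M[R]_(m, k)) (B : 'M[R]_(n, k)),
    [/\ hidden sigma i chi, phi = (fun x => A *m chi x) &
        psi = (fun x => B *m chi x)].
Proof.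
move=> hphi hpsi; have [j ej] : exists j, j = i by exists i.
rewrite -{1}ej in hpsi; elim: hphi n psi j hpsi ej => {i m phi}
    [|i m p phi W b p0 hphi IH] n psi j hpsi.
  case: hpsi => // _.
  exists d, id, 1%:M, 1%:M; split; first exact: hidden0.
    by apply/funext => x; rewrite mul1mx.
  by apply/funext => x; rewrite mul1mx.
case: hpsi => // {}j q {}n {}psi V c n0 hpsi [ji].
have [k [chi [A [B [hchi ephi epsi]]]]] := IH _ _ _ hpsi ji.
exists (p + n)%N,
  (fun x => map_mx sigma (col_mx (W *m A) (V *m B) *m chi x + col_mx b c)),
  (row_mx 1%:M 0), (row_mx 0 1%:M); split.
- by apply: hiddenS => //; rewrite addn_gt0 p0.
- apply/funext => x; rewrite mul_col_mx add_col_mx map_col_mx mul_row_col.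
  by rewrite mul1mx mul0mx addr0 ephi mulmxA.
- apply/funext => x; rewrite mul_col_mx add_col_mx map_col_mx mul_row_col.
  by rewrite mul1mx mul0mx add0r epsi mulmxA.
Qed.

Lemma neural_network_lincomb c L (f g : 'cV[R]_d -> 'cV[R]_c) (lam : R) :
  neural_network sigma L f -> neural_network sigma L g ->
  neural_network sigma L (fun x => f x + lam *: g x).
Proof.
move=> [l [m [phi [W [b [-> hphi ->]]]]]] [_ [n [psi [V [e [[<-] hpsi ->]]]]]].
have [k [chi [A [B [hchi -> ->]]]]] := hidden_join hphi hpsi.
exists l, k, chi, (W *m A + lam *: (V *m B)), (b + lam *: e); split=> //.
apply/funext => x; rewrite mulmxDl -scalemxAl !mulmxA scalerDr.
by rewrite addrACA.
Qed.

Lemma mx_cvg (T : Type) (G : set_system T) {FG : Filter G} m n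
    (f : T -> 'M[R]_(m, n)) (M : 'M[R]_(m, n)) :
  (forall i j, (fun x => f x i j) @ G --> M i j) -> f @ G --> M.
Proof.
move=> fM A [P PM PA]; rewrite /nbhs/=.
have GP : \forall x \near G, forall i j, P i j (f x i j).
  by apply: filter_forall => i; apply: filter_forall => j; apply: fM; exact: PM.
by apply: filterS GP => x Px; apply: PA.
Qed.

Lemma mulmx_continuous m n p (A : 'M[R]_(m, n)) :
  continuous (fun B : 'M[R]_(n, p) => A *m B).
Proof.
move=> B; apply: (@mx_cvg _ (nbhs B)) => i j; rewrite mxE.
rewrite (_ : (fun _ => _) = (fun B : 'M[R]_(n, p) => \sum_k A i k * B k j)).
  by apply: cvg_bigsum => k; apply: cvgM; [exact: cvg_cst|exact: coord_continuous].
by apply/funext => C; rewrite mxE.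
Qed.

Lemma affine_continuous m n (W : 'M[R]_(m, n)) b (phi : 'cV[R]_d -> 'cV[R]_n) :
  continuous phi -> continuous (fun x => W *m phi x + b).
Proof.
move=> cphi x.
apply: (@cvgD _ _ _ (nbhs x) _ (fun y => W *m phi y) (fun=> b)); last exact: cvg_cst.
exact: (continuous_comp (cphi x) (@mulmx_continuous _ _ _ W _)).
Qed.

Lemma neural_network_continuous c L (f : 'cV[R]_d -> 'cV[R]_c) :
  continuous sigma -> neural_network sigma L f -> continuous f.
Proof.
move=> cs [l [m [phi [W [b [_ hphi ->]]]]]]; apply: affine_continuous.
elim: hphi => {l m phi W b} [x|l m n phi W b _ _ cphi x]; first exact: cvg_id.
apply: (@mx_cvg _ (nbhs x)) => i j; rewrite mxE.
rewrite (_ : (fun _ => _) = (fun x => sigma ((W *m phi x + b) i j))); last first.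
  by apply/funext => y; rewrite mxE.
have cx : (fun x => (W *m phi x + b) i j) @ x --> (W *m phi x + b) i j.
  apply: (cvg_comp (fun x => W *m phi x + b) (fun M : 'cV[R]_n => M i j)).
    exact: affine_continuous.
  exact: coord_continuous.
exact: (continuous_comp cx (cs _)).
Qed.

(** The scalar functions that are linear readouts of an [n]-th hidden layer.
    Recording a readout instead of the layer lets constructions of scalar
    networks proceed one layer at a time whatever the widths. *)
Definition scalar_layer n (h : 'cV[R]_d -> R) :=
  exists m (phi : 'cV[R]_d -> 'cV[R]_m) (w : 'rV[R]_m),
    hidden sigma n phi /\ forall x, (w *m phi x) 0 0 = h x.

Lemma scalar_layer0 (i : 'I_d) : scalar_layer 0 (fun x => x i 0).
Proof.
exists d, id, (delta_mx 0 i); split; first exact: hidden0.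
by move=> x; rewrite -rowE mxE.
Qed.

(** A layer of width [k] on top of a readout [h] is obtained from the rank-one
    weight matrix with column [s] and row the readout of [h]. *)
Lemma scalar_layerS n h k (s b c : 'I_k -> R) : (0 < k)%N ->
  scalar_layer n h ->
  scalar_layer n.+1 (fun x => \sum_j c j * sigma (s j * h x + b j)).
Proof.
move=> k0 [m [phi [w [hphi wh]]]].
exists k, (fun x => map_mx sigma ((\col_j s j) *m w *m phi x + \col_j b j)),
  (\row_j c j); split; first exact: hiddenS.
move=> x; rewrite mxE; apply: eq_bigr => j _.
by rewrite -mulmxA 4!mxE big_ord1 wh !mxE.
Qed.

Lemma scalar_layer_network n h c (e : 'cV[R]_c) : scalar_layer n h ->
  neural_network sigma n.+1 (fun x => h x *: e).
Proof.
move=> [m [phi [w [hphi wh]]]]; exists n, m, phi, (e *m w), 0; split=> //.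
apply/funext => x; rewrite addr0 -mulmxA (mx11_scalar (w *m phi x)) wh.
by rewrite mul_mx_scalar.
Qed.

Lemma scalar_layer_unary n h :
  scalar_layer n h -> scalar_layer n.+1 (sigma \o h).
Proof.
move=> /(@scalar_layerS n h 1 (fun=> 1) (fun=> 0) (fun=> 1) isT).
congr scalar_layer; apply/funext => x.
by rewrite big_ord1 !mul1r addr0.
Qed.

Lemma scalar_layer_iter n (i : 'I_d) :
  scalar_layer n (fun x => iter n sigma (x i 0)).
Proof.
elim: n => [|n IH]; first exact: scalar_layer0.
exact: (scalar_layer_unary IH).
Qed.

End NetworkClass.

(** * Hat functions as ReLU networks *)

Section Hat.
Context {R : realType}.

Definition hat (t0 r t : R) : R :=
  relu (t - (t0 - r)) - 2 * relu (t - t0) + relu (t - (t0 + r)).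

Lemma hatE (t0 r t : R) : 0 < r -> hat t0 r t = relu (r - `|t - t0|).
Proof.
move=> r0; rewrite /hat /relu !maxEle.
by case: (leP 0 (t - t0)) => h; [rewrite ger0_norm//|rewrite ltr0_norm//];
  repeat case: ifP; lra.
Qed.

Lemma relu_continuous : continuous (@relu R).
Proof.
move=> x; rewrite /relu.
apply: (@continuous_max _ _ (fun=> 0) id); [exact: cvg_cst|exact: cvg_id].
Qed.

(** The hat is nonnegative, hence fixed by ReLU: one layer produces it and
    the following ones carry it along. *)
Lemma hat_layer d n (i : 'I_d) (t0 r : R) : 0 < r ->
  scalar_layer relu n.+1 (fun x : 'cV[R]_d => hat t0 r (x i 0)).
Proof.
move=> r0; elim: n => [|n IH]; last first.
  have := scalar_layer_unary IH; congr scalar_layer; apply/funext => x/=.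
  by rewrite hatE// {1}/relu max_r// le_max lexx.
pose c (j : 'I_3) : R := nth 0 [:: 1; -2; 1] j.
pose b (j : 'I_3) : R := nth 0 [:: r - t0; - t0; - t0 - r] j.
have := scalar_layerS (fun=> 1) b c isT (scalar_layer0 relu i).
congr scalar_layer; apply/funext => x.
rewrite !big_ord_recl big_ord0 /b /c /= /hat !mul1r addr0 addrA mulNr.
by congr (relu _ - 2 * _ + relu _); ring.
Qed.

End Hat.

(** * Iterated partial derivatives *)

Lemma mdeg0 d : @mdeg d [ffun=> 0%N] = 0%N.
Proof. by rewrite /mdeg big1// => i _; rewrite ffunE. Qed.

Definition multiindex0 d k : multiindex d k :=
  exist (fun b : {ffun 'I_d -> nat} => (mdeg b <= k)%N) [ffun=> 0%N]
    (eq_ind_r (fun n => (n <= k)%N) (leq0n k) (mdeg0 d)).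

Section PartialDerivatives.
Context {R : realType} {d c : nat}.
Implicit Types (f g : 'cV[R]_d -> 'cV[R]_c) (s : seq 'I_d) (x : 'cV[R]_d).

Lemma size_mi_dirs (b : {ffun 'I_d -> nat}) : size (mi_dirs b) = mdeg b.
Proof.
rewrite /mi_dirs size_flatten /shape -map_comp sumnE big_map /mdeg big_enum/=.
by apply: eq_bigr => i _; rewrite size_nseq.
Qed.

Lemma mi_dirs0 (b : {ffun 'I_d -> nat}) : mdeg b = 0%N -> mi_dirs b = [::].
Proof. by move=> b0; apply: size0nil; rewrite size_mi_dirs. Qed.

(** Iterated derivatives depend only on germs.  The conclusion holds near [x]
    and not only at [x], which is what the induction on [s] needs. *)
Lemma pderiv_near_eq s f g x :
  (\near x, f x = g x) -> \forall y \near x, pderiv s f y = pderiv s g y.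
Proof.
elim: s => [//|i s IH] /= /IH /near_join; apply: filterS => y fg.
exact: near_eq_derive.
Qed.

Lemma pderivable_near_eq s f g x :
  (\near x, f x = g x) -> pderivable s f x -> pderivable s g x.
Proof.
elim: s x => [//|i s IH] x /= fg [nf df]; split.
  by apply: filterS2 (near_join fg) nf => y; exact: IH.
by apply: near_eq_derivable df; exact: pderiv_near_eq.
Qed.

Lemma Ck_at_near_eq k f g x :
  (\near x, f x = g x) -> Ck_at k f x -> Ck_at k g x.
Proof.
move=> /near_join fg; apply: filterS2 fg => y fg Cf b; have [pf cf] := Cf b.
split; first exact: pderivable_near_eq pf.
have ds := pderiv_near_eq (mi_dirs (sval b)) fg.
have ey := nbhs_singleton ds.
rewrite /prop_for /continuous_at -ey.
by apply: cvg_trans cf; exact: (near_eq_cvg ds).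
Qed.

Lemma pderiv0 s : pderiv s (fun=> 0 : 'cV[R]_c) = fun=> 0.
Proof.
elim: s => [//|i s IH] /=; apply/funext => x; rewrite IH.
exact: (derive_cst (0 : 'cV[R]_c)).
Qed.

Lemma pderivable0 s x : pderivable s (fun=> 0 : 'cV[R]_c) x.
Proof.
elim: s x => [//|i s IH] x /=; split; first by apply: (@nearW _ (nbhs x)) => y; exact: IH.
by rewrite pderiv0; exact: derivable_cst.
Qed.

Lemma Ck_at0 k x : Ck_at k (fun=> 0 : 'cV[R]_c) x.
Proof.
apply: (@nearW _ (nbhs x)) => y b; split; first exact: pderivable0.
by rewrite pderiv0; exact: cst_continuous.
Qed.

Lemma pderiv_near0 s f x : (\near x, f x = 0) ->
  {for x, continuous (pderiv s f)} /\ pderiv s f x = 0.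
Proof.
move=> f0; have ds : \forall y \near x, pderiv s (fun=> 0) y = pderiv s f y.
  by apply: pderiv_near_eq; apply: filterS f0 => y ->.
have ex := nbhs_singleton ds.
have cx : {for x, continuous (pderiv s (fun=> 0 : 'cV[R]_c))}.
  by rewrite pderiv0; exact: cst_continuous.
split; last by rewrite -ex pderiv0.
rewrite /prop_for /continuous_at -ex.
by apply: cvg_trans cx; exact: (near_eq_cvg ds).
Qed.

Lemma pderiv_lincomb s f g (lam : R) x :
  pderivable s f x -> pderivable s g x ->
  pderiv s (fun y => f y + lam *: g y) x = pderiv s f x + lam *: pderiv s g x.
Proof.
elim: s x => [//|i s IH] x /= [nf df] [ng dg].
rewrite (@near_eq_derive _ _ _ _ (pderiv s f + lam \*: pderiv s g)); last first.
  by apply: filterS2 nf ng => y; exact: IH.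
have dlg : derivable (lam \*: pderiv s g) x (delta_mx i 0) by exact: derivableZ.
by rewrite (deriveD df dlg) (deriveZ lam dg).
Qed.

Lemma is_derive_ridge (i j : 'I_d) (phi : R -> R) (e : 'cV[R]_c) x :
  derivable phi (x i 0) 1 ->
  is_derive x (delta_mx j 0) (fun y => phi (y i 0) *: e)
    ((if j == i then derive1 phi (x i 0) else 0) *: e).
Proof.
move=> dphi.
have cv : h^-1 *: (((fun y : 'cV[R]_d => phi (y i 0) *: e) \o shift x) (h *: delta_mx j 0)
    - phi (x i 0) *: e) @[h --> (0 : R)^'] -->
    (if j == i then derive1 phi (x i 0) else 0) *: e.
  case: eqVneq => [->|ji]; last first.
    rewrite scale0r.
    refine (cvg_trans (near_eq_cvg _) (cvg_cst (0 : 'cV[R]_c))).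
    apply: filterE => h /=.
    by rewrite !mxE eq_sym (negbTE ji) mulr0 add0r subrr scaler0.
  have dphi' : h^-1 *: ((phi \o shift (x i 0)) (h *: 1) - phi (x i 0))
      @[h --> (0 : R)^'] --> derive1 phi (x i 0) by rewrite derive1E; exact: dphi.
  refine (cvg_trans (near_eq_cvg _) (@cvgZr_tmp _ _ _ _ _ _ _ e dphi')).
  apply: filterE => h /=.
  by rewrite !mxE !eqxx -scalerBl scalerA.
by split; [apply/cvg_ex; eexists; exact: cv|exact: cvg_lim cv].
Qed.

(** A ridge function in the [i]-th coordinate has nonzero derivatives only in
    direction [i], where they are those of its profile. *)
Lemma pderiv_ridge k (i : 'I_d) (phi : R -> R) (e : 'cV[R]_c) s :
  Ck_real k phi -> (size s <= k)%N ->
  pderiv s (fun y => phi (y i 0) *: e) =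
  fun x => (if all (pred1 i) s then derive1n (size s) phi (x i 0) else 0) *: e.
Proof.
move=> [dphi _]; elim: s => [//|j s IH] /= sk; apply/funext => x.
rewrite IH ?(ltnW sk)//.
case: (all _ s) => /=; last first.
  by rewrite andbF scale0r; exact: (derive_cst (0 : 'cV[R]_c)).
have [_ dr] := @is_derive_ridge i j (derive1n (size s) phi) e x (dphi _ _ sk).
by rewrite andbT; exact: dr.
Qed.

Lemma pderiv_ridge_continuous k (i : 'I_d) (phi : R -> R) (e : 'cV[R]_c) s :
  Ck_real k phi -> (size s <= k)%N ->
  continuous (pderiv s (fun y => phi (y i 0) *: e)).
Proof.
move=> Cphi sk x; rewrite (pderiv_ridge _ _ Cphi sk).
case: (all (pred1 i) s); last first.
  by rewrite scale0r; exact: cst_continuous.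
have c1 : y i 0 @[y --> x] --> x i 0 by exact: coord_continuous.
have [_ cphi] := Cphi; have c2 := cvg_comp _ _ c1 (cphi _ sk (x i 0)).
exact: (@cvgZr_tmp _ _ _ _ _ _ _ e c2).
Qed.

End PartialDerivatives.

(** * Derivatives of functions on the closure of an open set *)

Section Restrictions.
Context {R : realType} {d c : nat}.
Variable Om : set 'cV[R]_d.
Hypothesis openOm : open Om.
Implicit Types (f g : 'cV[R]_d -> 'cV[R]_c) (u w : closure Om -> 'cV[R]_c).
Local Notation res f := (sigL (closure Om) f).

Lemma valL_sigL f z : closure Om z -> 'valL_ 0 (res f) z = f z.
Proof.
move=> cz; have := @sigLK _ _ (0 : 'cV[R]_c) (closure Om).
move=> /(congr1 (fun F => F f z)) /= ->.
by rewrite /restrict /patch mem_set.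
Qed.

Lemma valL_out u z : ~ closure Om z -> 'valL_ 0 u z = 0.
Proof.
move=> cz; rewrite -[u](@valLK _ _ (0 : 'cV[R]_c) (closure Om)).
have := @sigLK _ _ (0 : 'cV[R]_c) (closure Om).
move=> /(congr1 (fun F => F ('valL_ 0 u) z)) /= ->.
by rewrite /restrict /patch memNset.
Qed.

Lemma valL_lincomb u w (lam : R) z :
  'valL_ 0 (u + lam *: w) z = 'valL_ 0 u z + lam *: 'valL_ 0 w z.
Proof.
have [cz|cz] := pselect (closure Om z); last first.
  by rewrite !valL_out// scaler0 addr0.
pose ext u := 'valL_ (0 : 'cV[R]_c) u.
have eu u' : u' = res (ext u') by rewrite /ext valLK.
have -> : u + lam *: w = res (fun z => ext u z + lam *: ext w z).
  by rewrite {1}(eu u) {1}(eu w).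
exact: valL_sigL.
Qed.

Lemma valL_add u w z : 'valL_ 0 (u + w) z = 'valL_ 0 u z + 'valL_ 0 w z.
Proof. by rewrite -{1}[w]scale1r valL_lincomb scale1r. Qed.

Lemma valL_scale (lam : R) u z : 'valL_ 0 (lam *: u) z = lam *: 'valL_ 0 u z.
Proof.
have -> : lam *: u = u + (lam - 1) *: u by rewrite scalerBl scale1r addrC subrK.
by rewrite valL_lincomb scalerBl scale1r addrC subrK.
Qed.

Lemma near_valL_sigL f z : Om z -> \forall x \near z, 'valL_ 0 (res f) x = f x.
Proof.
move=> Oz; have : nbhs z Om by apply: open_nbhs_nbhs.
by apply: filterS => x Ox; apply: valL_sigL; exact: subset_closure.
Qed.

(** For points inside the domain the extension by zero has the germ of [f];
    at boundary points the derivative is a limit from inside, which continuity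
    of the derivative of [f] identifies. *)
Lemma mderiv_sigL b f z : closure Om z ->
  {for z, continuous (pderiv (mi_dirs b) f)} ->
  mderiv b (res f) z = pderiv (mi_dirs b) f z.
Proof.
move=> cz cf; rewrite /mderiv; case: ifPn => [|_].
  case/orP => [/eqP/mi_dirs0 ->|/set_mem Oz]; first exact: valL_sigL.
  exact: (nbhs_singleton (pderiv_near_eq _ (near_valL_sigL f Oz))).
have FF : ProperFilter (within Om (nbhs z)) by exact: within_nbhs_proper.
apply: cvg_lim => //; refine (cvg_trans (near_eq_cvg _) (cvg_within_filter _ cf)).
rewrite near_withinE; apply: filterE => x Ox; apply/esym.
exact: (nbhs_singleton (pderiv_near_eq _ (near_valL_sigL f Ox))).
Qed.

Lemma mderiv_lincomb b u w (lam : R) z : closure Om z ->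
  mderivable b u z -> mderivable b w z ->
  mderiv b (u + lam *: w) z = mderiv b u z + lam *: mderiv b w z.
Proof.
move=> cz; rewrite /mderivable /mderiv.
have -> : 'valL_ 0 (u + lam *: w) = (fun z => 'valL_ 0 u z + lam *: 'valL_ 0 w z).
  by apply/funext => x; exact: valL_lincomb.
case: ((mdeg b == 0)%N || (z \in Om)) => [du dw|[du cu] [dw cw]].
  exact: (pderiv_lincomb lam du dw).
have FF : ProperFilter (within Om (nbhs z)) by exact: within_nbhs_proper.
apply: cvg_lim => //.
refine (cvg_trans (near_eq_cvg _) (cvgD cu (cvgZl_tmp (k := lam) cw))).
apply: filterS2 du dw => x du dw.
by rewrite (pderiv_lincomb lam du dw).
Qed.

Lemma mderiv_order0 u z : mderiv [ffun=> 0%N] u z = 'valL_ 0 u z.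
Proof.
by rewrite /mderiv mdeg0 eqxx/= mi_dirs0// mdeg0.
Qed.

End Restrictions.

(** * Measure and measurability of sets of tuples *)

Section LebesgueTupleGeometry.
Context {R : realType}.
Local Notation mR := (measurableTypeR R).

Definition point_of_tuple d (t : d.-tuple mR) : 'cV[R]_d := \col_i (tnth t i : R).

Definition cube d (q : 'I_d -> R) (r : R) : set 'cV[R]_d :=
  [set x | forall i, `|x i 0 - q i| < r].

Lemma cubeE d (q : 'I_d -> R) (r : R) :
  @point_of_tuple d @^-1` cube q r =
  \bigcap_(i in [set: 'I_d]) ((@tnth d mR)^~ i @^-1` `](q i - r), (q i + r)[%classic).
Proof.
apply/seteqP; split=> t /= H i; have := H i.
  by rewrite mxE /= in_itv/= ltr_distl.
by rewrite mxE /= in_itv/= ltr_distl; apply.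
Qed.

Lemma measurable_cube d (q : 'I_d -> R) (r : R) :
  measurable (@point_of_tuple d @^-1` cube q r).
Proof.
rewrite cubeE; apply: fin_bigcap_measurable => // i _.
rewrite -[X in measurable X]setTI; apply: measurable_tnth => //.
Qed.

(** The sigma-algebra on tuples is generated by coordinates, so cubes are
    measurable, and an open set is the countable union of the cubes with
    rational centre and radius [1 / (n + 1)] that it contains. *)
Lemma measurable_open d (A : set 'cV[R]_d) :
  open A -> measurable (@point_of_tuple d @^-1` A).
Proof.
move=> oA.
pose I := ({ffun 'I_d -> rat} * nat)%type.
pose box (k : I) := cube (fun i => ratr (k.1 i) : R) k.2.+1%:R^-1.
pose pick (k : I) := if `[< box k `<=` A >] then box k else set0.
have -> : A = \bigcup_k pick k.
  apply/seteqP; split=> [x Ax|x [k _]]; last first.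
    by rewrite /pick; case: ifPn => [/asboolP + bx|//]; apply.
  have /nbhs_ballP[e /= e0 eA] : nbhs x A by apply: open_nbhs_nbhs.
  have [n ne] : exists n : nat, n.+1%:R^-1 < e / 2.
    have e20 : 0 < e / 2 by rewrite divr_gt0.
    have [n _ /(_ n (leqnn n)) ne] := near_infty_natSinv_lt (PosNum e20).
    by exists n.
  have n0 : 0 < n.+1%:R^-1 :> R by rewrite invr_gt0.
  have /choice[q qx] : forall i, exists q : rat, `|x i 0 - ratr q| < n.+1%:R^-1.
    move=> i; have [q] := @rat_in_itvoo R (x i 0 - n.+1%:R^-1) (x i 0 + n.+1%:R^-1)
      ltac:(by rewrite ltrD2l gtrN).
    by rewrite in_itv/= -ltr_distl distrC => ?; exists q.
  exists ([ffun i => q i], n) => //; rewrite /pick; case: ifPn => [_ i|/asboolP[]].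
    by rewrite ffunE; exact: qx.
  move=> y yq; apply: eA; split=> // i j; rewrite (ord1 j) /ball/=.
  have := yq i; rewrite ffunE => yqi.
  have := ltrD (qx i) yqi; have := ler_distD (ratr (q i)) (x i 0) (y i 0).
  rewrite (distrC (ratr (q i))) => h1 h2 /=; apply: le_lt_trans h1 (lt_trans h2 _).
  by rewrite [ltRHS]splitr; exact: ltrD.
rewrite preimage_bigcup; apply: countable_bigcupT_measurable => [|k].
  exact: countableP.
by rewrite /pick; case: ifP => _; [exact: measurable_cube|rewrite preimage_set0].
Qed.

(** By induction on the dimension: removing the first coordinate turns a cube
    into the product of a cube and an interval of length [2 r]. *)
Lemma lebesgue_tuple_cube d (q : 'I_d -> R) (r : R) : 0 < r ->
  lebesgue_tuple R d (@point_of_tuple d @^-1` cube q r) = ((r *+ 2) ^+ d)%:E.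
Proof.
move=> r0; elim: d q => [|d IH] q.
  rewrite expr0 (_ : _ @^-1` _ = setT); first exact: diracT.
  by apply/seteqP; split=> // t _ [].
rewrite /= /pushforward.
rewrite (_ : _ @^-1` _ = (@point_of_tuple d @^-1` cube (q \o lift ord0) r) `*`
    `](q ord0 - r), (q ord0 + r)[%classic); last first.
  apply/seteqP; split=> [[t s] H|[t s] [Ht Hs] i] /=.
    split=> [i /=|/=].
      by have := H (lift ord0 i); rewrite !mxE /= tnthS.
    by have := H ord0; rewrite mxE /= tnth0 in_itv/= -ltr_distl.
  rewrite mxE; have [j ->|->] := unliftP ord0 i.
    by have := Ht j; rewrite mxE /= tnthS.
  by move: Hs; rewrite /= in_itv/= -ltr_distl tnth0.
rewrite product_measure1E//; last exact: measurable_cube.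
rewrite [X in (X * _)%E](_ : _ = ((r *+ 2) ^+ d)%:E); last exact: IH.
rewrite [X in (_ * X)%E]lebesgue_measure_itv/= lte_fin.
have -> : q ord0 - r < q ord0 + r by rewrite ltrD2l gtrN.
rewrite -EFinB -EFinM exprSr; congr (_ * _)%:E.
by rewrite opprB addrC addrA subrK mulr2n.
Qed.

Lemma bounded_in_cube d (Om : set 'cV[R]_d) : bounded_set Om ->
  exists2 r : R, 0 < r & Om `<=` cube (fun=> 0) r.
Proof.
move=> [M [_ /(_ (Num.max M 0 + 1))]]; rewrite ltr_pwDr// ?le_max ?lexx//.
move=> /(_ isT) OmM; exists (Num.max M 0 + 2).
  by rewrite ltr_wpDl// le_max lexx orbT.
move=> x /OmM xM i; rewrite subr0; apply: le_lt_trans (_ : Num.max M 0 + 1 < _).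
  apply: le_trans xM; rewrite [leRHS](_ : _ = mx_norm x)// mx_normrE.
  exact: (le_bigmax _ (fun i : 'I_d * 'I_1 => `|x i.1 i.2|) (i, 0)).
by rewrite ltrD2l ltr1n.
Qed.

Lemma lebesgue_tuple_bounded d (Om : set 'cV[R]_d) : open Om -> bounded_set Om ->
  (lebesgue_tuple R d (@point_of_tuple d @^-1` Om) < +oo)%E.
Proof.
move=> oO /bounded_in_cube[r r0 Or].
apply: (@le_lt_trans _ _ (lebesgue_tuple R d (@point_of_tuple d @^-1` cube (fun=> 0) r))).
  apply: le_measure; rewrite ?inE; [exact: measurable_open|exact: measurable_cube|].
  exact: preimage_subset.
by rewrite lebesgue_tuple_cube// ltry.
Qed.

(** The closure is a closed subset of a closed box, and the box is compact as
    the transpose of a product of segments. *)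
Lemma compact_closure_bounded d (Om : set 'cV[R]_d) :
  bounded_set Om -> compact (closure Om).
Proof.
move=> /bounded_in_cube[r r0 Or].
pose K := [set v : 'rV[R]_d | forall i, v ord0 i \in `[(- r), r]].
have cK : compact K.
  by apply: (@rV_compact _ _ (fun=> `[(- r), r]%classic)) => _; exact: segment_compact.
have ctr : continuous (fun v : 'rV[R]_d => v^T).
  move=> v; apply: (@mx_cvg _ _ (nbhs v)) => i j; rewrite mxE.
  under eq_fun do rewrite mxE.
  exact: coord_continuous.
have cKT : compact [set v^T | v in K].
  by apply: continuous_compact => //; exact: continuous_subspaceT.
apply: (subclosed_compact _ cKT); first exact: closed_closure.
have hK : closed [set v^T | v in K].
  by apply: compact_closed => //; exact: norm_hausdorff.
rewrite [X in _ `<=` X](closure_id _).1//; apply: closureS => x /Or xr.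
exists x^T; last by rewrite trmxK.
by move=> i; rewrite mxE in_itv/= -ler_norml -[x _ _]subr0 ltW// ord1; exact: xr.
Qed.

Lemma measurable_fun_patch d (Om : set 'cV[R]_d) (h : 'cV[R]_d -> R) : open Om ->
  {within Om, continuous h} ->
  measurable_fun setT ((h \o @point_of_tuple d) \_ (@point_of_tuple d @^-1` Om)
    : d.-tuple mR -> mR).
Proof.
move=> oO; rewrite continuous_open_subspace// => ch.
apply/measurable_restrict => //; first exact: measurable_open.
rewrite setTI => mO; apply: (measurability _ (RGenOInfty.measurableE R)) => //.
move=> /= _ [_ [x ->] <-].
rewrite -[X in measurable X]/(@point_of_tuple d @^-1` (Om `&` h @^-1` `]x, +oo[%classic)).
apply: measurable_open; rewrite openE => z [Oz hz].
have nO : nbhs z Om by apply: open_nbhs_nbhs.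
have nh : nbhs z (h @^-1` `]x, +oo[%classic).
  apply: ch; first exact: mem_set.
  by apply: open_nbhs_nbhs; split.
exact: filterI.
Qed.

End LebesgueTupleGeometry.

(** * The Euclidean norm *)

Section EuclideanNorm.
Context {R : realType} {c : nat}.
Implicit Types x y : 'cV[R]_c.

Lemma lnorm2E x : lnorm 2 x = Num.sqrt (\sum_i x i 0 ^+ 2).
Proof.
rewrite /lnorm powR12_sqrt; last by apply: sumr_ge0 => i _; exact: powR_ge0.
by congr Num.sqrt; apply: eq_bigr => i _; rewrite powR_mulrn// real_normK ?num_real.
Qed.

Lemma lnorm2_ge0 x : 0 <= lnorm 2 x. Proof. exact: powR_ge0. Qed.

Lemma lnorm2_sqr x : lnorm 2 x ^+ 2 = \sum_i x i 0 ^+ 2.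
Proof. by rewrite lnorm2E sqr_sqrtr// sumr_ge0// => i _; exact: sqr_ge0. Qed.

Lemma lnorm2_eq0 x : lnorm 2 x = 0 -> x = 0.
Proof.
move=> x0; apply/colP => i; rewrite mxE; apply/eqP; rewrite -sqrf_eq0; apply/eqP.
have /eqP := lnorm2_sqr x; rewrite x0 expr0n eq_sym psumr_eq0.
  by move=> /allP /(_ i); rewrite mem_index_enum => /(_ isT) /eqP.
by move=> j _; exact: sqr_ge0.
Qed.

Lemma lnorm2Z (lam : R) x : lnorm 2 (lam *: x) = `|lam| * lnorm 2 x.
Proof.
rewrite !lnorm2E -sqrtr_sqr -sqrtrM ?sqr_ge0//; congr Num.sqrt.
by rewrite mulr_sumr; apply: eq_bigr => i _; rewrite mxE exprMn.
Qed.

(** Expand the nonnegative sum of the squares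
    [(|y| * x i - |x| * y i) ^ 2]. *)
Lemma cauchy_schwarz x y : \sum_i x i 0 * y i 0 <= lnorm 2 x * lnorm 2 y.
Proof.
have [/lnorm2_eq0 ->|x0] := eqVneq (lnorm 2 x) 0.
  rewrite big1 ?mulr_ge0 ?lnorm2_ge0// => i _; by rewrite mxE mul0r.
have [/lnorm2_eq0 ->|y0] := eqVneq (lnorm 2 y) 0.
  rewrite big1 ?mulr_ge0 ?lnorm2_ge0// => i _; by rewrite mxE mulr0.
have a0 : 0 < lnorm 2 x by rewrite lt0r lnorm2_ge0 andbT; exact: x0.
have b0 : 0 < lnorm 2 y by rewrite lt0r lnorm2_ge0 andbT; exact: y0.
have ab0 := mulr_gt0 a0 b0.
set a := lnorm 2 x in ab0 *; set b := lnorm 2 y in ab0 *.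
have : 0 <= \sum_i (b * x i 0 - a * y i 0) ^+ 2.
  by apply: sumr_ge0 => i _; exact: sqr_ge0.
rewrite (eq_bigr (fun i => b ^+ 2 * x i 0 ^+ 2 + (a ^+ 2 * y i 0 ^+ 2
  + (- (2 * (a * b))) * (x i 0 * y i 0)))); last by move=> i _; ring.
rewrite big_split/= big_split/= -!mulr_sumr -!lnorm2_sqr -/a -/b => h.
rewrite -(ler_pM2l ab0).
suff : 0 <= 2 * (a * b * (a * b) - a * b * \sum_i x i 0 * y i 0).
  by rewrite pmulr_rge0// subr_ge0.
by apply: le_trans h _; rewrite le_eqVlt; apply/orP; left; apply/eqP; ring.
Qed.

Lemma lnorm2D x y : lnorm 2 (x + y) <= lnorm 2 x + lnorm 2 y.
Proof.
have := cauchy_schwarz x y.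
move: (lnorm2_ge0 x) (lnorm2_ge0 y) (lnorm2_ge0 (x + y)).
move: (lnorm2_sqr x) (lnorm2_sqr y) (lnorm2_sqr (x + y)).
move: (lnorm 2 x) (lnorm 2 y) (lnorm 2 (x + y)) => a b s ha hb hs a0 b0 s0 cs.
rewrite -(@ler_pXn2r _ 2)// ?nnegrE ?addr_ge0// sqrrD ha hb hs.
rewrite (eq_bigr (fun i => x i 0 ^+ 2 + (y i 0 ^+ 2 + 2 * (x i 0 * y i 0)))); last first.
  by move=> i _; rewrite mxE; ring.
rewrite big_split/= big_split/= -mulr_sumr.
by rewrite addrA [leRHS]addrAC lerD2l mulr_natl lerMn2r cs orbT.
Qed.

Lemma lnorm2_continuous : continuous (lnorm 2 : 'cV[R]_c -> R).
Proof.
move=> x; rewrite (_ : lnorm 2 = fun y : 'cV[R]_c => Num.sqrt (\sum_i y i 0 ^+ 2)).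
  have cs : (fun y : 'cV[R]_c => \sum_i y i 0 ^+ 2) @ x --> \sum_i x i 0 ^+ 2.
    apply: (@cvg_bigsum _ _ (nbhs x)) => i.
    have ci : (fun y : 'cV[R]_c => y i 0) @ x --> x i 0 by exact: coord_continuous.
    exact: (cvg_comp _ _ ci (@exprn_continuous R 2 _)).
  exact: (cvg_comp _ _ cs (@sqrt_continuous R _)).
by apply/funext => y; exact: lnorm2E.
Qed.

End EuclideanNorm.

(** * The L^p norm of vector-valued continuous functions *)

Section LpNorm.
Context {R : realType} {d c : nat}.
Variable Om : set 'cV[R]_d.
Hypothesis openOm : open Om.
Hypothesis boundedOm : bounded_set Om.
Implicit Types u w : closure Om -> 'cV[R]_c.
Local Notation mu := (lebesgue_tuple R d).
Local Notation D := (@point_of_tuple R d @^-1` Om).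
Local Notation cont u := {within closure Om, continuous ('valL_ 0 u)}.

(** The real-valued integrand of the L^p norm, zero outside of the domain. *)
Definition pointwise_norm u : d.-tuple (measurableTypeR R) -> R :=
  ((fun z => lnorm 2 ('valL_ 0 u z)) \o @point_of_tuple R d) \_ D.

Lemma Lp_normE (p : R) u : Lp_norm p u = 'N[mu]_p%:E[EFin \o pointwise_norm u]%E.
Proof. by rewrite /Lp_norm /pointwise_norm -restrict_EFin. Qed.

Lemma measurable_pointwise_norm u : cont u ->
  measurable_fun setT (pointwise_norm u : _ -> measurableTypeR R).
Proof.
move=> cu; apply: measurable_fun_patch => //.
have cu' : {within Om, continuous ('valL_ 0 u)}.
  by apply: continuous_subspaceW cu; exact: subset_closure.
by move=> z; exact: (cvg_comp _ _ (cu' z) (@lnorm2_continuous R c _)).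
Qed.

Lemma pointwise_norm_ge0 u t : 0 <= pointwise_norm u t.
Proof. by rewrite /pointwise_norm /patch; case: ifP => // _; exact: lnorm2_ge0. Qed.

Lemma pointwise_norm_in u t : Om (point_of_tuple t) ->
  pointwise_norm u t = lnorm 2 ('valL_ 0 u (point_of_tuple t)).
Proof. by move=> Ot; rewrite /pointwise_norm /patch mem_set. Qed.

Lemma pointwise_norm_out u t : ~ Om (point_of_tuple t) -> pointwise_norm u t = 0.
Proof. by move=> Ot; rewrite /pointwise_norm /patch memNset. Qed.

Lemma within_lincomb u w (lam : R) : cont u -> cont w -> cont (u + lam *: w).
Proof.
move=> cu cw.
have -> : 'valL_ 0 (u + lam *: w) = (fun z => 'valL_ 0 u z + lam *: 'valL_ 0 w z).
  by apply/funext => z; exact: valL_lincomb.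
move=> z; apply: cvgD; first exact: cu.
by apply: cvgZl_tmp; exact: cw.
Qed.

Lemma within_scale u (lam : R) : cont u -> cont (lam *: u).
Proof.
move=> cu; have -> : 'valL_ 0 (lam *: u) = (fun z => lam *: 'valL_ 0 u z).
  by apply/funext => z; exact: valL_scale.
by move=> z; apply: cvgZl_tmp; exact: cu.
Qed.

Lemma measurable_powR_norm (p : R) (f : d.-tuple (measurableTypeR R) -> R) :
  measurable_fun setT (f : _ -> measurableTypeR R) ->
  measurable_fun setT ((fun t => `|f t| `^ p) : _ -> measurableTypeR R).
Proof.
move=> mf.
have mn : measurable_fun setT ((fun t => `|f t|) : _ -> measurableTypeR R).
  exact: measurableT_comp mf.
exact: (measurableT_comp (measurable_powR p) mn).
Qed.

Lemma Lnorm_EFin (p : R) (f : d.-tuple (measurableTypeR R) -> R) :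
  'N[mu]_p%:E[EFin \o f]%E = ((\int[mu]_t (`|f t| `^ p)%:E) `^ p^-1)%E.
Proof. by rewrite unlock. Qed.

(** The function is bounded on the compact closure and the domain has finite
    measure. *)
Lemma Lp_norm_fin (p : R) u : 1 <= p -> cont u -> (Lp_norm p u < +oo)%E.
Proof.
move=> p1 cu; have p0 : 0 < p by exact: lt_le_trans p1.
have mD : measurable D by exact: measurable_open.
rewrite Lp_normE Lnorm_EFin; apply: poweR_lty.
have cK : compact ((fun z => lnorm 2 ('valL_ 0 u z)) @` closure Om).
  apply: (@continuous_compact _ _ (fun z => lnorm 2 ('valL_ 0 u z)) (closure Om)).
    by move=> z; exact: (cvg_comp _ _ (cu z) (@lnorm2_continuous R c _)).
  exact: compact_closure_bounded.
have [M [_ /(_ (M + 1))]] := @compact_bounded _ _ _ cK.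
rewrite ltrDl ltr01 => /(_ isT) uM.
set C := M + 1 in uM.
apply: (@le_lt_trans _ _ (\int[mu]_(t in D) (`|C| `^ p)%:E)%E); last first.
  rewrite integral_cst// lte_mul_pinfty ?lee_fin ?powR_ge0//.
  exact: lebesgue_tuple_bounded.
rewrite [leRHS]integral_mkcond; apply: ge0_le_integral => //.
- apply/measurable_EFinP.
  exact: (measurable_powR_norm _ (measurable_pointwise_norm cu)).
- by apply/(measurable_restrict _ mD measurableT); exact: measurable_cst.
move=> t _; rewrite /patch; case: ifPn => [/set_mem Dt|/negP tD].
  rewrite /= lee_fin ge0_ler_powR ?nnegrE ?normr_ge0// ?(ltW p0)//.
  rewrite ger0_norm ?pointwise_norm_ge0// pointwise_norm_in//.
  apply: le_trans (ler_norm _) (le_trans _ (ler_norm _)).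
  by apply: uM; exists (point_of_tuple t) => //; exact: subset_closure.
have {}tD : ~ Om (point_of_tuple t) by move=> Ot; apply: tD; apply: mem_set.
by rewrite /= pointwise_norm_out// normr0 powR0// gt_eqF.
Qed.

Lemma Lp_norm_ge0 (p : R) u : (0 <= Lp_norm p u)%E.
Proof. exact: Lnorm_ge0. Qed.

Lemma Lp_normZ (p : R) (lam : R) u : 1 <= p -> cont u ->
  Lp_norm p (lam *: u) = (`|lam|%:E * Lp_norm p u)%E.
Proof.
move=> p1 cu; have p0 : 0 < p by exact: lt_le_trans p1.
have e t : pointwise_norm (lam *: u) t = `|lam| * pointwise_norm u t.
  have [Ot|nOt] := pselect (Om (point_of_tuple t)); last first.
    by rewrite !pointwise_norm_out// mulr0.
  by rewrite (pointwise_norm_in _ Ot) valL_scale lnorm2Z (pointwise_norm_in _ Ot).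
have I1 : (\int[mu]_t (`|pointwise_norm (lam *: u) t| `^ p)%:E =
    \int[mu]_t ((`|lam| `^ p)%:E * (`|pointwise_norm u t| `^ p)%:E))%E.
  apply: eq_integral => t _.
  by rewrite (e t) normrM normr_id (powRM _ (normr_ge0 _) (normr_ge0 _)) EFinM.
transitivity ((\int[mu]_t ((`|lam| `^ p)%:E * (`|pointwise_norm u t| `^ p)%:E)) `^ p^-1)%E.
  by rewrite Lp_normE Lnorm_EFin I1.
rewrite (Lp_normE p u) Lnorm_EFin.
rewrite ge0_integralZl ?lee_fin ?powR_ge0//; last first.
  apply/measurable_EFinP.
  exact: (measurable_powR_norm _ (measurable_pointwise_norm cu)).
rewrite poweRM ?lee_fin ?powR_ge0//; last first.
  by apply: integral_ge0 => t _; rewrite lee_fin powR_ge0.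
congr (_ * _)%E.
by rewrite poweR_EFin -powRrM mulfV ?gt_eqF// powRr1.
Qed.

(** The triangle inequality of the Euclidean norm bounds the integrand
    pointwise, and the rest is the scalar Minkowski inequality. *)
Lemma Lp_norm_triangle (p : R) u w : 1 <= p -> cont u -> cont w ->
  (Lp_norm p (u + w)%R <= Lp_norm p u + Lp_norm p w)%E.
Proof.
move=> p1 cu cw; have p0 : 0 < p by exact: lt_le_trans p1.
have cuw : cont (u + w) by rewrite -[w]scale1r; exact: within_lincomb.
have mfu := measurable_pointwise_norm cu.
have mw := measurable_pointwise_norm cw.
have muw := measurable_pointwise_norm cuw.
rewrite !Lp_normE; apply: le_trans (minkowski_EFin _ mfu mw p1).
rewrite (Lnorm_EFin _ (pointwise_norm (u + w))).
rewrite (Lnorm_EFin _ (pointwise_norm u \+ pointwise_norm w)).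
have int0 (f : d.-tuple (measurableTypeR R) -> R) :
    (\int[mu]_t (`|f t| `^ p)%:E)%E \in `[0%E, +oo%E].
  by rewrite in_itv/= leey andbT integral_ge0// => t _; rewrite lee_fin powR_ge0.
apply: gt0_ler_poweR; [by rewrite invr_ge0 ltW|exact: int0|exact: int0|].
apply: ge0_le_integral => //.
- apply/measurable_EFinP.
  exact: (measurable_powR_norm _ muw).
- apply/measurable_EFinP.
  exact: (measurable_powR_norm _ (measurable_funD mfu mw)).
move=> t _; rewrite /= lee_fin ge0_ler_powR ?nnegrE ?normr_ge0// ?(ltW p0)//.
rewrite !ger0_norm ?addr_ge0 ?pointwise_norm_ge0//.
have [Ot|nOt] := pselect (Om (point_of_tuple t)); last first.
  by rewrite !pointwise_norm_out// addr0.
rewrite (pointwise_norm_in (u + w) Ot) valL_add.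
rewrite (pointwise_norm_in u Ot) (pointwise_norm_in w Ot).
exact: lnorm2D.
Qed.

(** If the norm were zero the function would vanish almost everywhere, but by
    continuity it is nonzero on a cube around [z], which has positive measure. *)
Lemma Lp_norm_gt0 (p : R) u z : 1 <= p -> cont u -> Om z -> 'valL_ 0 u z != 0 ->
  (0 < Lp_norm p u)%E.
Proof.
move=> p1 cu Oz uz; have p0 : 0 < p by exact: lt_le_trans p1.
rewrite lt_def Lp_norm_ge0 andbT; apply/eqP; rewrite Lp_normE => norm0.
have mfu : measurable_fun setT (EFin \o pointwise_norm u).
  by apply/measurable_EFinP; exact: measurable_pointwise_norm.
have [|N [mN N0 sub]] := Lnorm_eq0_eq0 mfu _ norm0; first by rewrite lte_fin.
have : nbhs z (Om `&` [set x | 'valL_ 0 u x != 0]).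
  apply: filterI; first exact: open_nbhs_nbhs.
  have cu' : {in Om, continuous ('valL_ 0 u)}.
    rewrite -continuous_open_subspace//; apply: continuous_subspaceW cu.
    exact: subset_closure.
  have : nbhs ('valL_ 0 u z) [set y : 'cV[R]_c | y != 0].
    apply: open_nbhs_nbhs; split => //.
    rewrite (_ : [set y | y != 0] = ~` [set (0 : 'cV[R]_c)]).
      apply: closed_openC; apply: accessible_closed_set1.
      by apply: hausdorff_accessible; exact: norm_hausdorff.
    by apply/seteqP; split=> y /= h; apply/eqP.
  by apply: cu'; exact: mem_set.
move=> /nbhs_ballP[r /= r0 rO].
have cubeN : @point_of_tuple R d @^-1` cube (fun i => z i 0) r `<=` N.
  move=> t tr; apply: sub => /=.
  have [Ot ut] : (Om `&` [set x | 'valL_ 0 u x != 0]) (point_of_tuple t).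
    apply: rO; split => // i j; rewrite (ord1 j) /ball/= distrC; exact: tr.
  move=> /(_ I) [] /eqP; rewrite pointwise_norm_in// => /eqP/lnorm2_eq0/eqP.
  exact/negP.
set Q := cube _ r in cubeN.
have : (mu (@point_of_tuple R d @^-1` Q) <= mu N)%E.
  by apply: le_measure => //; rewrite inE; [exact: measurable_cube|exact: mN].
by rewrite N0 lebesgue_tuple_cube// lee_fin leNgt exprn_gt0// mulr2n addr_gt0.
Qed.

End LpNorm.

(** * Perturbing a function by a flat one *)

Section Perturbation.
Context {R : realType} {d c : nat}.
Variable Om : set 'cV[R]_d.
Hypothesis openOm : open Om.
Implicit Types u w Phi : closure Om -> 'cV[R]_c.
Local Notation cont u := {within closure Om, continuous ('valL_ 0 u)}.

(** The data points are nodes, and the value at a node is the derivative of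
    order zero there. *)
Lemma pinn_loss_eq cF cB rF rB nu
    (F : 'cV[R]_d -> (multiindex d rF -> 'cV[R]_c) -> 'cV[R]_cF)
    (B : 'cV[R]_d -> (multiindex d rB -> 'cV[R]_c) -> 'cV[R]_cB)
    (Oh Gh Dh : set 'cV[R]_d) (aF aB aD : R) (wF wB wD : 'cV[R]_d -> R)
    (ustar : 'cV[R]_d -> 'cV[R]_c) u w :
  Dh `<=` Oh `|` Gh ->
  (forall z (b : multiindex d rF), Oh z -> mderiv (sval b) u z = mderiv (sval b) w z) ->
  (forall z (b : multiindex d rB), Gh z -> mderiv (sval b) u z = mderiv (sval b) w z) ->
  pinn_loss nu F B Oh Gh Dh aF aB aD wF wB wD ustar u =
  pinn_loss nu F B Oh Gh Dh aF aB aD wF wB wD ustar w.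
Proof.
move=> DOG uwF uwB; rewrite /pinn_loss.
have valE z : Dh z -> 'valL_ 0 u z = 'valL_ 0 w z.
  rewrite -!mderiv_order0 => /DOG[Oz|Gz].
    exact: (uwF z (multiindex0 d rF) Oz).
  exact: (uwB z (multiindex0 d rB) Gz).
have eF z : Oh z -> local_op F u z = local_op F w z.
  by move=> Oz; rewrite /local_op; congr F; apply/funext => b; exact: uwF.
have eB z : Gh z -> local_op B u z = local_op B w z.
  by move=> Gz; rewrite /local_op; congr B; apply/funext => b; exact: uwB.
have sF : \sum_(z \in Oh) wF z * lnorm nu (local_op F u z) `^ nu =
    \sum_(z \in Oh) wF z * lnorm nu (local_op F w z) `^ nu.
  by apply: eq_fsbigr => z /set_mem hz; rewrite (eF z hz).
have sB : \sum_(z \in Gh) wB z * lnorm nu (local_op B u z) `^ nu =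
    \sum_(z \in Gh) wB z * lnorm nu (local_op B w z) `^ nu.
  by apply: eq_fsbigr => z /set_mem hz; rewrite (eB z hz).
have sD : \sum_(z \in Dh) wD z * lnorm nu ('valL_ 0 u z - ustar z) `^ nu =
    \sum_(z \in Dh) wD z * lnorm nu ('valL_ 0 w z - ustar z) `^ nu.
  by apply: eq_fsbigr => z /set_mem hz; rewrite (valE z hz).
exact: (f_equal2 +%R (f_equal2 +%R (f_equal ( *%R aF) sF) (f_equal ( *%R aB) sB))
  (f_equal ( *%R aD) sD)).
Qed.

(** Write [lam *: Phi] as the difference of [u + lam *: Phi - w] and [u - w].
    Both norms in [lower] are finite and that of [Phi] is positive, so [lower]
    is affine in [|lam|] with positive slope. *)
Lemma Lp_norm_growth (p : R) u Phi w z : bounded_set Om -> 1 <= p ->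
  cont u -> cont Phi -> cont w -> Om z -> 'valL_ 0 Phi z != 0 ->
  let lower := fun lam : R =>
    (`|lam|%:E * Lp_norm p Phi - Lp_norm p (u - w)%R)%E in
  [/\ forall lam : R, (lower lam <= Lp_norm p (u + lam *: Phi - w)%R)%E,
      lower @ abs_pinfty --> +oo%E &
      (fun lam : R => Lp_norm p (u + lam *: Phi - w)) @ abs_pinfty --> +oo%E].
Proof.
move=> bO p1 cu cPhi cw Oz Phiz lower.
have cuw : cont (u - w) by rewrite -scaleN1r; exact: within_lincomb.
have Pfin := Lp_norm_fin openOm bO p1 cPhi.
have gfin := Lp_norm_fin openOm bO p1 cuw.
have Ppos := Lp_norm_gt0 openOm p1 cPhi Oz Phiz.
have sub_le (x y v : \bar R) : y \is a fin_num -> (x <= v + y -> x - y <= v)%E.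
  by move=> yf xvy; rewrite leeBlDr.
have lowerE lam : (lower lam <= Lp_norm p (u + lam *: Phi - w)%R)%E.
  have -> : u + lam *: Phi - w = (u - w) + lam *: Phi by rewrite addrAC.
  have gn : Lp_norm p (u - w) \is a fin_num.
    by rewrite ge0_fin_numE; [exact: gfin|exact: Lp_norm_ge0].
  suff le : (`|lam|%:E * Lp_norm p Phi <=
      Lp_norm p ((u - w) + lam *: Phi)%R + Lp_norm p (u - w)%R)%E.
    exact: (sub_le _ _ _ gn le).
  have chg : cont ((u - w) + lam *: Phi) by exact: within_lincomb.
  have cg : cont ((-1) *: (u - w)) by exact: within_scale.
  have := Lp_norm_triangle openOm p1 chg cg.
  have -> : (u - w) + lam *: Phi + (-1) *: (u - w) = lam *: Phi.
    by rewrite scaleN1r addrAC subrr add0r.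
  rewrite (Lp_normZ openOm lam p1 cPhi) (Lp_normZ openOm (-1) p1 cuw).
  by rewrite normrN1 mul1e.
have lim : lower @ abs_pinfty --> +oo%E.
  move: Pfin gfin Ppos; rewrite /lower.
  move: (Lp_norm_ge0 p Phi) (Lp_norm_ge0 p (u - w)).
  case: (Lp_norm p Phi) => [N| |]//; case: (Lp_norm p (u - w)) => [C| |]//.
  rewrite !lee_fin lte_fin => N0 C0 _ _ Npos A [M [_ MA]].
  exists ((M + C) / N) => lam; rewrite ltr_pdivrMr// => lamM.
  by apply: MA; rewrite -EFinM -EFinB lte_fin ltrBrDr.
split=> // A [M [Mr MA]]; have [K lamK] := lim _ (ex_intro _ M (conj Mr (fun y h => h))).
by exists K => lam /lamK h; apply: MA; apply: lt_le_trans h (lowerE lam).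
Qed.

(** Moving from [z] along the [i]-th axis stays in the open domain for a while,
    so the coordinate takes all values near [z i]. *)
Lemma near_coordinate (i : 'I_d) (z : 'cV[R]_d) : Om z ->
  \forall t \near z i 0, exists2 x : 'cV[R]_d, Om x & x i 0 = t.
Proof.
move=> Oz; pose line (t : R) : 'cV[R]_d := z + (t - z i 0) *: delta_mx i 0.
have ct : (fun t : R => t - z i 0) @ z i 0 --> z i 0 - z i 0.
  by apply: cvgB; [exact: cvg_id|exact: cvg_cst].
have cl := cvgD (cvg_cst z) (@cvgZr_tmp _ _ _ _ _ _ _ (delta_mx i 0 : 'cV[R]_d) ct).
rewrite subrr scale0r addr0 in cl.
have : \forall t \near z i 0, Om (line t) by apply: cl; exact: open_nbhs_nbhs.
apply: filterS => t Ot; exists (line t) => //.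
by rewrite !mxE !eqxx mulr1 addrC subrK.
Qed.

Lemma sigL_within (f : 'cV[R]_d -> 'cV[R]_c) : continuous f -> cont (sigL (closure Om) f).
Proof.
move=> cf; apply: (@subspace_eq_continuous _ _ _ f).
  by move=> z /set_mem cz; apply/esym; exact: valL_sigL.
exact: continuous_subspaceT.
Qed.

Lemma Ck_on_within k (u : closure Om -> 'cV[R]_c) : Ck_on (closure Om) k u -> cont u.
Proof.
move=> /(_ (multiindex0 d k)) [_ cu].
have -> : 'valL_ 0 u = mderiv (sval (multiindex0 d k)) u; last exact: cu.
by apply/funext => z; apply/esym; exact: mderiv_order0.
Qed.

End Perturbation.

(** * Networks flat at the nodes *)

Section FlatNetworks.
Context {R : realType} {d c : nat}.
Variables (Om : set 'cV[R]_d) (i0 : 'I_d) (e : 'cV[R]_c).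
Hypotheses (openOm : open Om) (Om0 : Om !=set0) (e0 : e != 0).
Variables (I : finType) (node : I -> 'cV[R]_d).

Lemma near_dnbhs_neq (t a : R) : \forall s \near t^', s != a.
Proof.
have [->|ta] := eqVneq a t; first exact: nbhs_dnbhs_neq.
apply: cvg_within; have : open [set s : R | s != a] by exact: open_neq.
by move=> oa; apply: open_nbhs_nbhs; split=> //=; rewrite eq_sym.
Qed.

Lemma coordinate_avoiding :
  exists2 z, Om z & forall q, node q i0 0 != z i0 0.
Proof.
have [z Oz] := Om0.
have n1 : \forall t \near (z i0 0)^', exists2 x : 'cV[R]_d, Om x & x i0 0 = t.
  by apply: cvg_within; exact: near_coordinate.
have n2 : \forall t \near (z i0 0)^', forall q, t != node q i0 0.
  by apply: filter_forall => q; exact: near_dnbhs_neq.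
have [t /= [[x Ox xt] tq]] := @filter_ex _ _ (Proper_dnbhs_numFieldType (z i0 0)) _ (filterI n1 n2).
by exists x => // q; rewrite xt eq_sym.
Qed.

(** The hat is centred at a coordinate value [z i0] that no node has, and its
    half-width [r] is smaller than the distance from [z i0] to the coordinates
    of the nodes; it therefore vanishes around each of them. *)
Lemma relu_flat_network n :
  exists f : 'cV[R]_d -> 'cV[R]_c,
    [/\ neural_network relu n.+2 f,
        exists2 z, Om z & f z != 0 &
        forall q, \forall x \near node q, f x = 0].
Proof.
have [z Oz zq] := coordinate_avoiding.
have n1 : \forall r \near (0 : R)^'+, forall q, r < `|node q i0 0 - z i0 0|.
  apply: filter_forall => q; apply: nbhs_right_lt.
  by rewrite normr_gt0 subr_eq0.
have [r /= [r0 rq]] :=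
  @filter_ex _ _ (at_right_proper_filter (0 : R)) _ (filterI (nbhs_right_gt (0 : R)) n1).
exists (fun x => hat (z i0 0) r (x i0 0) *: e); split.
- apply: (@scalar_layer_network _ _ _ n.+1 (fun x => hat (z i0 0) r (x i0 0))).
  exact: hat_layer.
- exists z => //; rewrite hatE// subrr normr0 subr0 scaler_eq0 negb_or e0 andbT.
  by rewrite /relu max_r ?gt_eqF// ltW.
move=> q.
have cx : (fun x : 'cV[R]_d => `|x i0 0 - z i0 0|) @ node q -->
      `|node q i0 0 - z i0 0|.
  have c1 : (fun x : 'cV[R]_d => x i0 0) @ node q --> node q i0 0.
    exact: coord_continuous.
  exact: (cvg_norm (cvgB c1 (cvg_cst (z i0 0)))).
have nx : \forall x \near node q, r < `|(x : 'cV[R]_d) i0 0 - z i0 0|.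
  exact: (cx _ (lt_nbhsr (rq q))).
apply: filterS nx => x rx.
rewrite hatE// /relu max_l ?scale0r// subr_le0; exact: ltW.
Qed.

(** There are [sum_q (r q).+1] linear conditions, at most [l], on the [l + 1]
    coefficients [w]. *)
Lemma smooth_flat_network (sigma : R -> R) (a : R) (l n : nat) (r : I -> nat) :
  Ck_real l sigma ->
  (forall k, (k <= l)%N -> derive1n k sigma a != 0) ->
  ((0 < n)%N -> strictly_monotone sigma) ->
  (\sum_q (r q).+1 <= l)%N ->
  exists f : 'cV[R]_d -> 'cV[R]_c,
    [/\ neural_network sigma n.+2 f,
        exists2 z, Om z & f z != 0 &
        forall q s, (size s <= r q)%N ->
          {for node q, continuous (pderiv s f)} /\ pderiv s f (node q) = 0].
Proof.
move=> Cs sa ms rl; have [z0 Oz0] := Om0.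
have rql q : (r q <= l)%N.
  by apply: leq_trans rl; rewrite (bigD1 q)//=; apply: leq_trans (leqnSn _) (leq_addr _ _).
pose tau := iter n sigma; pose y0 := tau (z0 i0 0).
have Ctau : Ck_real l tau by exact: Ck_real_iter.
pose b (k : 'I_l.+1) : R := a - k%:R * y0.
pose f1 (k : 'I_l.+1) (t : R) : R := sigma (k%:R * tau t + b k).
have Cf1 k : Ck_real l (f1 k).
  exact: (Ck_real_comp Cs (Ck_real_comp (Ck_real_affine l k%:R (b k)) Ctau)).
pose A (k : 'I_l.+1) (q : {q : I & 'I_(r q).+1}) : R :=
  derive1n (tagged q) (f1 k) (node (tag q) i0 0).
have [|w [[k wk] wA]] := underdetermined_system A.
  rewrite card_tagged sumnE big_map big_enum/= ltnS.
  by under eq_bigr do rewrite card_ord.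
pose g (t : R) : R := \sum_k w k * f1 k t.
have Cg : Ck_real l g by exact: Ck_real_lincomb.
exists (fun x => g (x i0 0) *: e); split.
- apply: scalar_layer_network.
  exact: (scalar_layerS (fun k : 'I_l.+1 => k%:R) b w (ltn0Sn l)
    (scalar_layer_iter sigma n i0)).
- apply: contrapT => nz; have gz z : Om z -> g (z i0 0) = 0.
    move=> Oz; apply/eqP; apply: contra_notT nz => gz; exists z => //.
    by rewrite scaler_eq0 negb_or gz.
  pose P (y : R) := \sum_(j < l.+1) w j * sigma (j%:R * y + (a - j%:R * y0)) = 0.
  have nP : \forall t \near z0 i0 0, P (tau t).
    have := near_coordinate openOm i0 Oz0.
    by apply: filterS => t [z Oz <-]; exact: (gz z Oz).
  have mtau : strictly_monotone tau.
    have [n0|n0] := posnP n; last by apply: strictly_monotone_iter => //; exact: ms.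
    by rewrite /tau n0; left.
  have nPy := strictly_monotone_open (Ck_real_continuous Ctau) mtau nP.
  by have := ridge_lincomb_eq0 Cs sa nPy k; apply/eqP.
move=> q s sq; have sl : (size s <= l)%N by apply: leq_trans sq (rql q).
split; first exact: (@pderiv_ridge_continuous R d c l i0 g e s Cg sl (node q)).
rewrite (pderiv_ridge _ _ Cg sl); case: (all _ s); last by rewrite scale0r.
rewrite (derive1n_lincomb w Cf1 sl).
have := wA (Tagged (fun q => 'I_(r q).+1) (Ordinal (sq : (size s < (r q).+1)%N))).
by rewrite /A /= => ->; rewrite scale0r.
Qed.

End FlatNetworks.

(** * Nonuniqueness of minimizers *)

Theorem mainTheorem5 (R : realType)
    (d c cF cB NF NB rF rB : nat)
    (hd : (0 < d)%N) (hc : (0 < c)%N) (hcF : (0 < cF)%N) (hcB : (0 < cB)%N)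
    (hNF : (0 < NF)%N) (hNB : (0 < NB)%N)
    (nu : R) (hnu : 1 <= nu)
    (Om : set 'cV[R]_d) (hOm : bounded_lipschitz_domain Om)
    (Gam : set 'cV[R]_d) (hGam : Gam `<=` closure Om `\` Om°)
    (U : completeNormedModType R)
    (ev : {linear U -> (closure Om -> 'cV[R]_c)}) (hev : injective ev)
    (hU : forall v : U, Ck_on Om rF (ev v) /\ Ck_on (closure Om) rB (ev v))
    (F : 'cV[R]_d -> (multiindex d rF -> 'cV[R]_c) -> 'cV[R]_cF)
    (B : 'cV[R]_d -> (multiindex d rB -> 'cV[R]_c) -> 'cV[R]_cB)
    (zF : 'I_NF -> 'cV[R]_d) (hzF : forall i, Om (zF i))
    (zB : 'I_NB -> 'cV[R]_d) (hzB : forall j, Gam (zB j))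
    (Dh : set 'cV[R]_d) (hDh : Dh `<=` range zF `|` range zB)
    (ustar : 'cV[R]_d -> 'cV[R]_c)
    (aF aB aD : R) (haF : 0 <= aF) (haB : 0 <= aB) (haD : 0 <= aD)
    (wF wB wD : 'cV[R]_d -> R)
    (L : nat) (H : set (closure Om -> 'cV[R]_c))
    (hHreg : H `<=` node_regular rF rB (range zF) (range zB))
    (hH :
      (H = relu_reg_class L (maxn rF rB) Om (range zF `|` range zB) /\
       ((up_log 2 d.+1).+1 <= L)%N)
      \/
      (exists sigma : R -> R,
        let l := (NF * rF.+1 + NB * rB.+1)%N in
        [/\ H = network_class sigma L Om,
            Ck_real l sigma,
            exists a : R, forall k, (k <= l)%N -> (derive1n k sigma) a != 0,
            (2 <= L)%N &
            (2 < L)%N -> strictly_monotone sigma]))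
    (uth : closure Om -> 'cV[R]_c) :
  let J := pinn_loss nu F B (range zF) (range zB) Dh aF aB aD wF wB wD ustar in
  minimizer J H uth ->
  exists Phi : closure Om -> 'cV[R]_c,
    [/\ H Phi,
        Phi <> 0,
        (forall (i : 'I_NF) (b : multiindex d rF),
          mderiv (sval b) Phi (zF i) = 0) /\
        (forall (j : 'I_NB) (b : multiindex d rB),
          mderiv (sval b) Phi (zB j) = 0),
        forall lam : R, minimizer J H (uth + lam *: Phi) &
        forall uhat : U,
          (forall z, Om z -> local_op F (ev uhat) z = 0) ->
          (forall z, Gam z -> local_op B (ev uhat) z = 0) ->
          forall p : R, 1 <= p ->
            let lower := fun lam : R =>
              (`|lam|%:E * Lp_norm p Phi - Lp_norm p (uth - ev uhat)%R)%E in
            [/\ forall lam : R,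
                  (lower lam <= Lp_norm p (uth + lam *: Phi - ev uhat)%R)%E,
                lower @ abs_pinfty --> +oo%E &
                (fun lam : R => Lp_norm p (uth + lam *: Phi - ev uhat))
                  @ abs_pinfty --> +oo%E]].
Proof.
move=> J minu; have [openOm _ Om0 boundedOm _] := hOm.
pose i0 := Ordinal hd; pose e : 'cV[R]_c := const_mx 1.
have e0 : e != 0.
  apply/eqP => /colP /(_ (Ordinal hc)); rewrite !mxE; apply/eqP; exact: oner_neq0.
pose node (q : 'I_NF + 'I_NB) := match q with inl i => zF i | inr j => zB j end.
pose r (q : 'I_NF + 'I_NB) := match q with inl _ => rF | inr _ => rB end.
have cnode q : closure Om (node q).
  by case: q => [i|j]; [apply: subset_closure; exact: hzF|have [] := hGam _ (hzB j)].
have sum_r : (\sum_q (r q).+1 = NF * rF.+1 + NB * rB.+1)%N.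
  by rewrite big_sumType/= !sum_nat_const !card_ord.
have [f1 [f [uthE [cf1 cf] fz flat [Hf Hlin]]]] :
    exists f1 f : 'cV[R]_d -> 'cV[R]_c,
    [/\ uth = sigL (closure Om) f1, continuous f1 /\ continuous f,
        exists2 z, Om z & f z != 0,
        forall q s, (size s <= r q)%N ->
          {for node q, continuous (pderiv s f)} /\ pderiv s f (node q) = 0 &
        H (sigL (closure Om) f) /\
        forall lam, H (sigL (closure Om) (fun x => f1 x + lam *: f x))].
  (* In the ReLU case flatness comes from vanishing near the nodes, which also
     preserves the regularity demanded there by the class. *)
  case: hH => [[HE hL]|[sigma [HE Cs [a sa] L2 ms]]].
    have [n nL] : exists n, L = n.+2.
      have : (1 < L)%N by apply: leq_ltn_trans hL; rewrite up_log_gt0.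
      by case: (L) => [|[|n]]// _; exists n.
    have [f [nnf fz f0]] := relu_flat_network i0 openOm Om0 e0 node n.
    have := minu.1; rewrite HE nL => -[f1 [nn1 Ck1] uthE].
    have cr := @relu_continuous R.
    exists f1, f; split=> //.
    - split; first exact: (neural_network_continuous cr nn1).
      exact: (neural_network_continuous cr nnf).
    - by move=> q s _; exact: pderiv_near0.
    have nodes z : (range zF `|` range zB) z -> exists q, z = node q.
      by case=> [[i _ <-]|[j _ <-]]; [exists (inl i)|exists (inr j)].
    split.
      exists f; last by []; split; first exact: nnf.
      move=> z /nodes[q ->].
      apply: (@Ck_at_near_eq _ _ _ _ (fun=> 0)); last exact: Ck_at0.
      by apply: filterS (f0 q) => x ->.
    move=> lam; exists (fun x => f1 x + lam *: f x); last by [].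
    split; first exact: neural_network_lincomb.
    move=> z nz; have [q zq] := nodes z nz.
    apply: Ck_at_near_eq (Ck1 z nz); rewrite zq.
    by apply: filterS (f0 q) => x ->; rewrite scaler0 addr0.
  have [n nL] : exists n, L = n.+2 by case: (L) L2 => [|[|n]]// _; exists n.
  have ms' : (0 < n)%N -> strictly_monotone sigma.
    by move=> n0; apply: ms; rewrite nL !ltnS.
  have rl : (\sum_q (r q).+1 <= NF * rF.+1 + NB * rB.+1)%N by rewrite sum_r.
  have [f [nnf fz flat]] :=
    smooth_flat_network i0 openOm Om0 e0 node Cs sa ms' rl.
  have := minu.1; rewrite HE nL => -[f1 nn1 uthE].
  have cs := Ck_real_continuous Cs.
  exists f1, f; split=> //.
    split; first exact: (neural_network_continuous cs nn1).
    exact: (neural_network_continuous cs nnf).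
  split; first by exists f.
  move=> lam; exists (fun x => f1 x + lam *: f x); last by [].
  exact: neural_network_lincomb.
pose Phi := sigL (closure Om) f.
have linE lam : uth + lam *: Phi = sigL (closure Om) (fun x => f1 x + lam *: f x).
  by rewrite uthE.
have [z Oz fz0] := fz.
have Phiz : 'valL_ 0 Phi z != 0.
  by rewrite valL_sigL//; exact: subset_closure.
have dPhi q (b : {ffun 'I_d -> nat}) : (mdeg b <= r q)%N ->
    mderiv b Phi (node q) = 0.
  rewrite -size_mi_dirs => /(flat q)[cb b0].
  by rewrite (mderiv_sigL openOm (cnode q) cb).
have HPhi : H Phi by [].
have cPhi : {within closure Om, continuous ('valL_ 0 Phi)} by exact: sigL_within.
have cuth : {within closure Om, continuous ('valL_ 0 uth)}.
  by rewrite uthE; exact: sigL_within.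
exists Phi; split; first exact: HPhi.
- move=> Phi0; case/eqP: Phiz; rewrite Phi0.
  by rewrite -(scale0r (0 : closure Om -> 'cV[R]_c)) valL_scale scale0r.
- split=> [i b|j b]; first exact: (dPhi (inl i) _ (svalP b)).
  exact: (dPhi (inr j) _ (svalP b)).
- move=> lam; split; first by rewrite linE.
  move=> v Hv; apply: le_trans (minu.2 v Hv); rewrite le_eqVlt; apply/orP; left.
  apply/eqP; apply: pinn_loss_eq => //.
    move=> _ b [i _ <-].
    have [ru _] := hHreg _ minu.1; have [rPhi _] := hHreg _ HPhi.
    rewrite (mderiv_lincomb lam (cnode (inl i))).
    + by rewrite (dPhi (inl i) _ (svalP b)) scaler0 addr0.
    + exact: (ru _ _ b).
    + exact: (rPhi _ _ b).
  move=> _ b [j _ <-].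
  have [_ ru] := hHreg _ minu.1; have [_ rPhi] := hHreg _ HPhi.
  rewrite (mderiv_lincomb lam (cnode (inr j))).
  + by rewrite (dPhi (inr j) _ (svalP b)) scaler0 addr0.
  + exact: (ru _ _ b).
  + exact: (rPhi _ _ b).
- move=> uhat _ _ p p1; apply: (Lp_norm_growth openOm boundedOm p1 cuth cPhi _ Oz Phiz).
  exact: Ck_on_within (hU uhat).2.
Qed.
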